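(* Let $p$ be a prime. There is an uncountable family of pairwise non-commensurable pro-$p$ groups that are pairwise isospectral. Likewise, there is an uncountable family of pairwise non-commensurable pro-$p$ groups that are pairwise normally isospectral.
   Context: For a finitely generated profinite group $\Gamma$ and $n\in\mathbb{N}$, let $a_n(\Gamma)$ denote the number of (open) subgroups of index $n$ in $\Gamma$ and $a_n^{\triangleleft}(\Gamma)$ the number of (open) normal subgroups of index $n$ in $\Gamma$. The zeta function of $\Gamma$ is the Dirichlet series $\zeta_\Gamma(s)=\sum_{n=1}^\infty a_n(\Gamma)n^{-s}$, and the normal zeta function of $\Gamma$ is $\zeta_\Gamma^{\triangleleft}(s)=\sum_{n=1}^\infty a_n^{\triangleleft}(\Gamma)n^{-s}$. Two (finitely generated) groups are isospectral if their zeta functions are the same, and normally isospectral if their normal zeta functions are the same. The pro-$p$ groups in question are (topologically) finitely generated, so that these zeta functions are defined. Two pro-$p$ groups are commensurable if they have open subgroups that are isomorphic to each other (as topological groups). *)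

(* Defs.v *)
From HB Require Import structures.
From mathcomp Require Import all_boot finmap.
From mathcomp Require Import boolp classical_sets functions cardinality.
From mathcomp Require Import topology.

Set Implicit Arguments.
Unset Strict Implicit.
Unset Printing Implicit Defensive.

Local Open Scope classical_set_scope.
Local Open Scope card_scope.
Local Open Scope group_scope.

HB.mixin Record isTopologicalGroup G & Topological G & Group G := {
  mulg_continuous : continuous (fun x : G * G => x.1 * x.2) ;
  invg_continuous : continuous (fun x : G => x^-1)
}.

#[short(type="topGroupType")]
HB.structure Definition TopologicalGroup :=
  {G of Topological G & Group G & isTopologicalGroup G}.

Section TopologicalGroups.
Variable G : topGroupType.
Implicit Types H S : set G.

Definition is_subgroup H : Prop := group_closed (mem H).

Definition is_normal_subgroup H : Prop :=
  is_subgroup H /\ forall x g, H x -> H (x ^ g).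

Definition left_coset (x : G) H : set G := [set x * h | h in H].

Definition has_index H (n : nat) : Prop :=
  [set left_coset x H | x in [set: G]] #= `I_n.

Definition gen_subgroup S : set G := smallest is_subgroup S.

Definition top_finitely_generated : Prop :=
  exists S, finite_set S /\ closure (gen_subgroup S) = [set: G].

Definition profinite : Prop :=
  [/\ compact [set: G], hausdorff_space G & totally_disconnected [set: G]].

Definition pro_p_group (p : nat) : Prop :=
  profinite /\
  forall N, open N -> is_normal_subgroup N -> exists k, has_index N (p ^ k)%N.

(* [fset_set] sends infinite sets to [fset0]; the two sets counted below are
   finite as soon as [G] is a topologically finitely generated profinite
   group. *)
Definition num_subgroups (n : nat) : nat :=
  #|` fset_set [set H | [/\ open H, is_subgroup H & has_index H n]] |.

Definition num_normal_subgroups (n : nat) : nat :=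
  #|` fset_set [set H | [/\ open H, is_normal_subgroup H & has_index H n]] |.

End TopologicalGroups.

Arguments profinite : clear implicits.
Arguments pro_p_group : clear implicits.
Arguments top_finitely_generated : clear implicits.
Arguments num_subgroups : clear implicits.
Arguments num_normal_subgroups : clear implicits.

(* The (formal) Dirichlet series sum_(n >= 1) a n * n^-s is encoded by its
   coefficient sequence a, normalised by a 0 = 0. The two series below satisfy
   this since no subgroup has index 0. They may diverge for every s (e.g. for
   nonabelian free pro-p groups), hence are not represented by functions of
   s. *)
Definition dirichlet_series : Type := nat -> nat.

Definition zeta (G : topGroupType) : dirichlet_series :=
  fun n => num_subgroups G n.

Definition normal_zeta (G : topGroupType) : dirichlet_series :=
  fun n => num_normal_subgroups G n.

Definition isospectral (G1 G2 : topGroupType) : Prop := zeta G1 = zeta G2.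

Definition normally_isospectral (G1 G2 : topGroupType) : Prop :=
  normal_zeta G1 = normal_zeta G2.

(* The functions [f] and [g] are total, but only their restrictions to [H1] and
   [H2], with the subspace topologies, matter. *)
Definition top_isomorphic_subgroups (G1 G2 : topGroupType)
    (H1 : set G1) (H2 : set G2) : Prop :=
  exists (f : G1 -> G2) (g : G2 -> G1),
    [/\ set_bij H1 H2 f, {in H1, cancel f g},
        {in H1 &, {morph f : x y / x * y}},
        {within H1, continuous f} & {within H2, continuous g}].

Definition commensurable (G1 G2 : topGroupType) : Prop :=
  exists (H1 : set G1) (H2 : set G2),
    [/\ open H1, is_subgroup H1, open H2, is_subgroup H2
      & top_isomorphic_subgroups H1 H2].

(* Main.v *)
Require Import Defs.
From HB Require Import structures.
From mathcomp Require Import all_boot all_algebra cyclic finmap.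
From mathcomp Require Import boolp classical_sets functions cardinality topology.
From mathcomp Require Import ring.

Set Implicit Arguments.
Unset Strict Implicit.
Unset Printing Implicit Defensive.
Import GRing.Theory.

Local Open Scope classical_set_scope.
Local Open Scope card_scope.
Local Open Scope ring_scope.

(** The groups are the semidirect products G_mu = Z_p |x Z_p^2 in which s in
    Z_p acts on Z_p^2 by diag (u^s, u^(mu s)), where u = 1 + p^2 and mu is a
    p-adic integer of valuation 1. They are p-adic analytic, and the Lie
    algebra of G_mu is Q_p acting on Q_p^2 through diag (1, mu), so that mu can
    be recovered from the commensurability class up to mu <-> 1/mu; the
    valuation of mu forbids the second possibility. On the other hand,
    counting subgroups sees mu only through a p-adic approximation.

    Subgroups. An open subgroup H of G_mu is determined by the generator p^m of
    its projection to Z_p, the lattice L of the elements of Z_p^2 in H, and an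
    element (p^m, v) of H, where v matters modulo L only
    ([open_subgroup_coord], [coord_subgroup_eqP]). The sole constraint on
    (m, L, v) is that L be stable under diag (u^(p^m), u^(mu p^m)). Such a
    matrix is a scalar plus p^(m+2) diag (0, unit), so the constraint is
    stability under p^(m+2) diag (0, 1), where mu has disappeared. The index is
    p^m [Z_p^2 : L], and therefore (m, L, v) |-> (m, L, v) matches the open
    subgroups of index n of any two groups of the family
    ([num_subgroups_indep]).

    Normal subgroups. Normality means that L is stable under
    p^2 diag (0, 1), that L contains (p^(m+2), 0) and (0, p^(m+3)), and that
    ((u - 1) v1, (u^mu - 1) v2) is in L ([coord_subgroup_normalP]). Only the
    last condition involves mu, through a factor u^mu - 1. If mu and mu' agree
    modulo p^3, then the quotient k of u^mu - 1 by u^mu' - 1 is a unit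
    congruent to 1 modulo p^2; then diag (1, k) preserves every lattice that
    is stable under p^2 diag (0, 1), and (m, L, (v1, v2)) |->
    (m, L, (v1, k v2)) matches the open normal subgroups
    ([num_normal_subgroups_indep]).

    Commensurability. An isomorphism f between open subgroups of G_mu and
    G_mu' respects the intersections with Z_p^2, because these consist of the
    elements commuting with all their conjugates. By continuity f is
    Z_p-linear there, so the eigenvalues u^(p^N), u^(mu p^N) of the action of
    (p^N, 0) are the eigenvalues u^s, u^(mu' s) of the action of its image
    (s, _). As s |-> u^s is injective, this leaves mu = mu' or mu mu' = 1, and
    the latter contradicts divisibility by p ([commensurable_eq]).

    The exponents mu = p + p^3 b, where b runs over the p-adic integers with
    digits 0 and 1, give one family that serves for both statements. *)

(** * Generalities on cardinals and on subgroups *)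

(** The common parameter set D replaces an explicit bijection between the two
    images: both are in bijection with one transversal of the fibers. *)
Lemma image_card_eq (T : choiceType) U V (D : set T) (f : T -> U) (g : T -> V) :
  (forall x y, D x -> D y -> f x = f y <-> g x = g y) -> f @` D #= g @` D.
Proof.
move=> fg; pose rep x := xget x [set y | D y /\ f y = f x].
have repP x : D x -> D (rep x) /\ f (rep x) = f x.
  by move=> Dx; apply: (@xgetPex _ x [set y | D y /\ f y = f x]); exists x.
have rep_eq x y : D x -> f x = f y -> rep x = rep y.
  move=> Dx fxy; rewrite /rep -fxy /xget; case: pselect => // -[].
  by exists x; apply/asboolP.
pose D0 := rep @` D.
have fD : f @` D = f @` D0.
  apply/seteqP; split=> _ [x Dx <-].
    by exists (rep x); [exists x|case: (repP x Dx)].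
  by case: Dx => y Dy <-; exists (rep y) => //; case: (repP y Dy).
have gD : g @` D = g @` D0.
  apply/seteqP; split=> _ [x Dx <-].
    have [Dr fr] := repP x Dx; exists (rep x); first by exists x.
    exact/fg.
  by case: Dx => y Dy <-; exists (rep y) => //; case: (repP y Dy).
have f_inj : {in D0 &, injective f}.
  move=> _ _ /set_mem[x Dx <-] /set_mem[y Dy <-].
  have [_ ->] := repP x Dx; have [_ ->] := repP y Dy; exact: rep_eq.
have g_inj : {in D0 &, injective g}.
  move=> x y xD yD gxy; apply: f_inj => //; apply/fg => //.
    by case/set_mem: xD => z /repP[? _] <-.
  by case/set_mem: yD => z /repP[? _] <-.
by rewrite fD gD (card_eql (inj_card_eq f_inj)) (card_eqr (inj_card_eq g_inj)).
Qed.

(** Equipotent sets are both finite or both infinite, and [fset_set] sends every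
    infinite set to the empty set. *)
Lemma card_eq_fset_set (T U : choiceType) (A : set T) (B : set U) :
  A #= B -> #|` fset_set A| = #|` fset_set B|.
Proof.
have fin_eq (T1 T2 : choiceType) (A1 : set T1) (A2 : set T2) :
    A1 #= A2 -> finite_set A1 -> finite_set A2.
  by move=> e /finite_setP[n An]; apply/finite_setP; exists n; rewrite -(card_eql e).
move=> AB; have [finA|infA] := pselect (finite_set A).
  by apply/fcard_eq => //; apply: fin_eq AB finA.
have infB : ~ finite_set B.
  by move=> finB; apply/infA/(fin_eq _ _ B) => //; rewrite card_eq_sym.
by rewrite /fset_set; case: pselect => // _; case: pselect.
Qed.

Lemma set_nat_uncountable : ~ countable [set: set nat].
Proof.
move=> /countable_injP[f f_inj].
pose A : set nat := [set n | exists S, f S = n /\ ~ S n].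
have nA : ~ A (f A).
  move=> AfA; have [S [eS nS]] := AfA; apply: nS.
  by rewrite (f_inj S A) ?inE.
by apply: (nA); exists A.
Qed.

Lemma is_subgroupP (G : topGroupType) (H : set G) : is_subgroup H <->
  [/\ H 1%g, forall x y, H x -> H y -> H (x * y)%g & forall x, H x -> H (x^-1)%g].
Proof.
split=> [sH|[H1 HM HV]].
  split=> [|x y /mem_set Hx /mem_set Hy|x /mem_set Hx]; apply: set_mem.
  - by case: sH.
  - exact: (group_closedM sH).
  - exact: (group_closedV sH).
split; first exact/mem_set.
by move=> x y /set_mem Hx /set_mem Hy; apply/mem_set/HM => //; apply: HV.
Qed.

Lemma subgroup_exp (G : topGroupType) (H : set G) x n :
  is_subgroup H -> H x -> H (x ^+ n)%g.
Proof.
move=> /is_subgroupP[H1 HM _] Hx; elim: n => [|n IHn]; first by rewrite expg0.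
by rewrite expgS; apply: HM.
Qed.

Lemma left_coset_eqP (K : topGroupType) (H : set K) x y : is_subgroup H ->
  left_coset x H = left_coset y H <-> H (x^-1 * y)%g.
Proof.
move=> /is_subgroupP[H1 HM HV]; split=> [e|Hxy].
  have : left_coset x H y by rewrite e; exists 1%g => //; rewrite mulg1.
  by move=> [h Hh <-]; rewrite mulKg.
apply/seteqP; split=> _ [h Hh <-].
  exists ((x^-1 * y)^-1 * h)%g; first by apply: HM => //; apply: HV.
  by rewrite invgM invgK !mulgA mulgV mul1g.
exists (x^-1 * y * h)%g; first exact: HM.
by rewrite !mulgA mulgV mul1g.
Qed.

Lemma has_index_uniq (G : topGroupType) (H : set G) m n :
  has_index H m -> has_index H n -> m = n.
Proof.
rewrite /has_index => Hm Hn; apply/card_eq_II.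
by rewrite -(card_eql Hm).
Qed.

(** * The ring of p-adic integers *)

(** Z_p as the inverse limit of the Z/p^n: [x n] is the representative in
    [0, p^n) of x modulo p^n. Writing p as [q.+2] makes the nonzero ring
    structure available from the number alone, with no proof of primality
    stored in the type. *)
Record padic (q : nat) := Padic {
  digits :> nat -> nat ;
  digitsP : forall n, (digits n.+1 %% q.+2 ^ n)%N = digits n }.

HB.instance Definition _ q := gen_eqMixin (padic q).
HB.instance Definition _ q := gen_choiceMixin (padic q).

Section PadicRing.
Variable q : nat.
Local Notation p := q.+2.
Implicit Types x y z : padic q.

Lemma padic_eq x y : (forall n, x n = y n) -> x = y.
Proof.
case: x y => [f fP] [g gP] /= fg; have {}fg : f = g by apply: funext.
by subst g; congr Padic; apply: Prop_irrelevance.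
Qed.

Lemma digits_modn x m n : (m <= n)%N -> (x n %% p ^ m)%N = x m.
Proof.
move=> /subnK <-; elim: (n - m)%N => [|k IHk].
  by rewrite add0n -digitsP modn_mod.
rewrite addSn -(@modn_dvdm (p ^ (k + m))) ?digitsP //.
by rewrite dvdn_exp2l // leq_addl.
Qed.

Lemma digits_mod x n : (x n %% p ^ n)%N = x n.
Proof. exact: digits_modn. Qed.

Lemma digits_ltn x n : (x n < p ^ n)%N.
Proof. by rewrite -digits_mod ltn_mod expn_gt0. Qed.

Definition compatible (f : nat -> nat) :=
  forall n, f n.+1 = f n %[mod p ^ n].

Lemma padic_of_subproof f : compatible f ->
  forall n, ((f n.+1 %% p ^ n.+1) %% p ^ n)%N = (f n %% p ^ n)%N.
Proof. by move=> fP n; rewrite modn_dvdm ?fP // dvdn_exp2l. Qed.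

Definition padic_of f (fP : compatible f) : padic q :=
  Padic (padic_of_subproof fP).

Lemma digits_compat x : compatible x.
Proof. by move=> n; rewrite digitsP digits_mod. Qed.

Lemma compat_const k : compatible (fun=> k). Proof. by []. Qed.

Lemma compat_add f g : compatible f -> compatible g ->
  compatible (fun n => f n + g n)%N.
Proof. by move=> fP gP n; rewrite -modnDm fP gP modnDm. Qed.

Lemma compat_mul f g : compatible f -> compatible g ->
  compatible (fun n => f n * g n)%N.
Proof. by move=> fP gP n; rewrite -modnMm fP gP modnMm. Qed.

Lemma compat_opp x : compatible (fun n => p ^ n - x n)%N.
Proof.
move=> n; apply/eqP; rewrite -(eqn_modDr (x n)) subnK ?modnn; last first.
  exact/ltnW/digits_ltn.
rewrite -[in X in (_ - _ + X)%N]digitsP modnDmr subnK; last first.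
  exact/ltnW/digits_ltn.
by rewrite expnS modnMl.
Qed.

Definition padd x y := padic_of (compat_add (digits_compat x) (digits_compat y)).
Definition pmul x y := padic_of (compat_mul (digits_compat x) (digits_compat y)).
Definition popp x := padic_of (@compat_opp x).
Definition pconst k := padic_of (compat_const k).

Lemma paddA : associative padd.
Proof. by move=> x y z; apply: padic_eq => n /=; rewrite modnDmr modnDml addnA. Qed.
Lemma paddC : commutative padd.
Proof. by move=> x y; apply: padic_eq => n /=; rewrite addnC. Qed.
Lemma padd0 : left_id (pconst 0) padd.
Proof. by move=> x; apply: padic_eq => n /=; rewrite mod0n digits_mod. Qed.
Lemma paddN : left_inverse (pconst 0) popp padd.
Proof.
move=> x; apply: padic_eq => n /=.
by rewrite modnDml subnK ?modnn ?mod0n //; apply/ltnW/digits_ltn.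
Qed.

HB.instance Definition _ :=
  GRing.isZmodule.Build (padic q) paddA paddC padd0 paddN.

Lemma pmulA : associative pmul.
Proof. by move=> x y z; apply: padic_eq => n /=; rewrite modnMmr modnMml mulnA. Qed.
Lemma pmulC : commutative pmul.
Proof. by move=> x y; apply: padic_eq => n /=; rewrite mulnC. Qed.
Lemma pmul1 : left_id (pconst 1) pmul.
Proof. by move=> x; apply: padic_eq => n /=; rewrite modnMml mul1n digits_mod. Qed.
Lemma pmulDl : left_distributive pmul padd.
Proof.
by move=> x y z; apply: padic_eq => n /=; rewrite modnMml modnDm mulnDl.
Qed.
Lemma padic1_neq0 : pconst 1 != pconst 0.
Proof.
by apply/eqP => /(congr1 (fun x => digits x 1)) /=; rewrite expn1 !modn_small.
Qed.

HB.instance Definition _ :=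
  GRing.Zmodule_isComNzRing.Build (padic q) pmulA pmulC pmul1 pmulDl padic1_neq0.

Lemma digitsD x y n : (x + y) n = ((x n + y n) %% p ^ n)%N.
Proof. by []. Qed.
Lemma digitsM x y n : (x * y) n = ((x n * y n) %% p ^ n)%N.
Proof. by []. Qed.
Lemma digits0 n : (0 : padic q) n = 0%N.
Proof. exact: mod0n. Qed.
Lemma digits_nat k n : (k%:R : padic q) n = (k %% p ^ n)%N.
Proof.
elim: k => [|k IHk]; first by rewrite digits0 mod0n.
by rewrite -addn1 natrD digitsD IHk modnDm.
Qed.

Lemma digits_congrD x x' y y' n :
  x n = x' n -> y n = y' n -> (x + y) n = (x' + y') n.
Proof. by move=> ex ey; rewrite !digitsD ex ey. Qed.
Lemma digits_congrM x x' y y' n :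
  x n = x' n -> y n = y' n -> (x * y) n = (x' * y') n.
Proof. by move=> ex ey; rewrite !digitsM ex ey. Qed.
Lemma digits_congrN x x' n : x n = x' n -> (- x) n = (- x') n.
Proof. by rewrite -[- x]mulN1r -[- x']mulN1r => ex; apply: digits_congrM. Qed.

Definition pdvd n x := exists y, x = p%:R ^+ n * y.

Lemma pdvd0 n : pdvd n 0. Proof. by exists 0; rewrite mulr0. Qed.
Lemma pdvdD n x y : pdvd n x -> pdvd n y -> pdvd n (x + y).
Proof. by move=> [a ->] [b ->]; exists (a + b); rewrite mulrDr. Qed.
Lemma pdvdN n x : pdvd n x -> pdvd n (- x).
Proof. by move=> [a ->]; exists (- a); rewrite mulrN. Qed.
Lemma pdvdB n x y : pdvd n x -> pdvd n y -> pdvd n (x - y).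
Proof. by move=> nx ny; apply: pdvdD => //; apply: pdvdN. Qed.
Lemma pdvdMl n x y : pdvd n x -> pdvd n (y * x).
Proof. by move=> [a ->]; exists (y * a); rewrite mulrCA. Qed.
Lemma pdvdMr n x y : pdvd n x -> pdvd n (x * y).
Proof. by rewrite mulrC; apply: pdvdMl. Qed.
Lemma pdvd_le m n x : (m <= n)%N -> pdvd n x -> pdvd m x.
Proof.
by move=> mn [a ->]; exists (p%:R ^+ (n - m) * a); rewrite mulrA -exprD subnKC.
Qed.
Lemma pdvdX n y : pdvd n (p%:R ^+ n * y). Proof. by exists y. Qed.

(** The quotient of x by p^n has residue [x (n + k) %/ p ^ n] modulo p^k. *)
Lemma digits_eq0P n x : x n = 0%N <-> pdvd n x.
Proof.
split=> [xn0|[y ->]]; last first.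
  by rewrite digitsM -natrX digits_nat modnn mul0n mod0n.
have dvdx k : (p ^ n %| x (n + k))%N.
  by apply/eqP; rewrite digits_modn ?leq_addr.
have cf : compatible (fun k => x (n + k) %/ p ^ n)%N.
  move=> k; rewrite addnS.
  have := divn_eq (x (n + k).+1) (p ^ (n + k)); rewrite digitsP => ->.
  rewrite expnD mulnCA -{1}(divnK (dvdx k)) [(_ %/ p ^ n * p ^ n)%N]mulnC -mulnDr.
  by rewrite mulKn ?expn_gt0 // modnMDl.
exists (padic_of cf); apply: padic_eq => k.
rewrite digitsM -natrX digits_nat /= modnMm mulnC divnK //.
by rewrite digits_modn ?leq_addl.
Qed.

Lemma digits_eqP n x y : x n = y n <-> pdvd n (x - y).
Proof.
split=> [xy|/digits_eq0P xy]; last first.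
  by rewrite -[x](subrK y) digitsD xy add0n digits_mod.
apply/digits_eq0P; have := digitsD (x - y) y n; rewrite subrK => e.
have : ((x - y)%R n + y n = 0 + y n %[mod p ^ n])%N.
  by rewrite -e xy add0n digits_mod.
by move/eqP; rewrite eqn_modDr mod0n digits_mod => /eqP.
Qed.

(** Density of the natural numbers, in the form used to pass from natural
    powers to p-adic ones. *)
Lemma approx x n : exists y, x = (x n)%:R + p%:R ^+ n * y.
Proof.
have /digits_eqP[y e] : x n = ((x n)%:R : padic q) n.
  by rewrite digits_nat digits_mod.
by exists y; rewrite -e addrC subrK.
Qed.

Lemma pX_mulI n x y : (p%:R ^+ n * x = p%:R ^+ n * y :> padic q) -> x = y.
Proof.
move=> e; apply/eqP; rewrite -subr_eq0; apply/eqP; move: (x - y) (mulrBr (p%:R ^+ n) x y).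
rewrite e subrr => {e} z z0; apply: padic_eq => k; rewrite digits0.
have := congr1 (fun u => digits u (n + k)) z0.
rewrite digits0 digitsM -natrX digits_nat modnMml.
rewrite expnD -muln_modr => /eqP; rewrite muln_eq0 expn_eq0 /= => /eqP.
by rewrite digits_modn ?leq_addl.
Qed.

Lemma pX_neq0 n : (p%:R ^+ n : padic q) <> 0.
Proof.
by rewrite -[X in X = _]mulr1 -[0](mulr0 (p%:R ^+ n)) => /pX_mulI/eqP; rewrite oner_eq0.
Qed.

Definition punit x := exists y, x * y = 1.
(** The elements of valuation exactly 1. *)
Definition pval1 x := exists2 u, punit u & x = p%:R * u.

Hypothesis p_prime : prime p.

(** The inverses modulo the p^n given by Euler's theorem are compatible, since
    an inverse modulo p^n is unique. *)
Lemma punit_digit1 x : x 1 <> 0%N -> punit x.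
Proof.
move=> x1.
have cop m n : (0 < n)%N -> coprime (x n) (p ^ m).
  case: m => [|m] n0; first by rewrite expn0 coprimen1.
  rewrite coprime_sym coprime_pexpl // prime_coprime //.
  by apply/negP => /eqP; rewrite -[p in (_ %% p)%N]expn1 digits_modn.
pose f n := (x n ^ (totient (p ^ n)).-1)%N.
have fx n : (0 < n)%N -> (f n * x n = 1 %[mod p ^ n])%N.
  move=> n0; rewrite /f -expnSr prednK; last by rewrite totient_gt0 expn_gt0.
  exact/Euler_exp_totient/cop.
have cf : compatible f.
  case=> [|n]; first by rewrite !expn0 !modn1.
  have e1 : (f n.+2 * x n.+1 = 1 %[mod p ^ n.+1])%N.
    rewrite -(digitsP x n.+1) modnMmr -(@modn_dvdm (p ^ n.+2)).
      by rewrite fx // modn_dvdm // dvdn_exp2l.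
    by rewrite dvdn_exp2l.
  rewrite -[f n.+2 in LHS]muln1 -modnMmr -(fx n.+1) // modnMmr.
  by rewrite mulnCA -modnMmr e1 modnMmr muln1.
exists (padic_of cf); apply: padic_eq => -[|n]; rewrite digitsM /=.
  by rewrite !expn0 !modn1.
by rewrite modnMmr mulnC fx.
Qed.

Lemma punit_neq0 x : punit x -> x 1 <> 0%N.
Proof.
move=> [y xy] x1; have := digitsM x y 1; rewrite x1 xy mul0n mod0n.
by rewrite -[1]/(1%:R) digits_nat modn_small // expn1.
Qed.

Lemma punit1 : punit 1. Proof. by exists 1; rewrite mulr1. Qed.
Lemma punitD x y : punit x -> pdvd 1 y -> punit (x + y).
Proof.
move=> /punit_neq0 x1 y1; apply: punit_digit1.
suff -> : (x + y) 1 = x 1 by [].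
by apply/digits_eqP; rewrite addrAC subrr add0r.
Qed.
Lemma punitN x : punit x -> punit (- x).
Proof. by move=> [a xa]; exists (- a); rewrite mulrNN. Qed.

Lemma padic_factor x : x <> 0 -> exists k, exists2 w, punit w & x = p%:R ^+ k * w.
Proof.
move=> x0; have exn : exists n, x n != 0%N.
  apply: contrapT => /forallNP e; apply: x0; apply: padic_eq => n.
  by rewrite digits0; apply/eqP/negPn/negP/e.
case: (ex_minnP exn) => -[|n] xn min.
  by move: xn; rewrite -(digits_mod x 0) expn0 modn1.
have /digits_eq0P[w xw] : x n = 0%N.
  by apply/eqP/negPn/negP => /min; rewrite ltnn.
exists n, w => //; apply: punit_digit1 => /digits_eq0P[z wz].
move/negP: xn; apply; apply/eqP/digits_eq0P; exists z.
by rewrite xw wz mulrA -exprD addn1.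
Qed.

Lemma padic_mulI x y z : x <> 0 -> x * y = x * z -> y = z.
Proof.
move=> /padic_factor[k [w [w' ww'] ->]]; rewrite -!mulrA => /pX_mulI e.
by rewrite -[y]mul1r -[z]mul1r -ww' mulrAC e mulrAC.
Qed.

Lemma padic_mul0 x y : x <> 0 -> x * y = 0 -> y = 0.
Proof. by move=> x0 e; apply: (padic_mulI x0); rewrite e mulr0. Qed.

End PadicRing.

(** * Powers of 1 + p^2 with p-adic exponents *)

Lemma expn1D_linear (P n : nat) :
  exists r, ((1 + P) ^ n = 1 + n * P + P ^ 2 * r)%N.
Proof.
elim: n => [|n [r IHn]]; first by exists 0%N; rewrite expn0 muln0.
by exists (n + r + r * P)%N; rewrite expnS IHn; ring.
Qed.

(** The factor p^2 in 1 + p^2 makes this hold for p = 2 as well: raising to the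
    power p the element 1 + p^(k+2) (1 + p z), the quadratic terms are
    multiples of p^(2k+4), hence of p^(k+4). *)
Lemma expn1p2_expp (p k : nat) :
  exists z, ((1 + p ^ 2) ^ (p ^ k) = 1 + p ^ (k + 2) * (1 + p * z))%N.
Proof.
elim: k => [|k [z IHk]]; first by exists 0%N; rewrite expn0 expn1; ring.
have [r e] := expn1D_linear (p ^ (k + 2) * (1 + p * z)) p.
exists (z + p ^ k * (1 + p * z) ^ 2 * r)%N.
by rewrite -(addn1 k) [(p ^ (k + 1))%N]expnD expnM IHk expn1 e !expnD; ring.
Qed.

Lemma expn1p2_mul (p k j : nat) : exists r,
  ((1 + p ^ 2) ^ (p ^ k * j) = 1 + p ^ (k + 2) * j + p ^ (k + 3) * r)%N.
Proof.
have [z e] := expn1p2_expp p k.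
have [r e'] := expn1D_linear (p ^ (k + 2) * (1 + p * z)) j.
exists (z * j + p ^ (k + 1) * (1 + p * z) ^ 2 * r)%N.
rewrite expnM e e' !expnD; ring.
Qed.

Section Power.
Variable q : nat.
Local Notation p := q.+2.
Local Notation padic := (padic q).
Implicit Types (x y z s r j mu : padic).

Lemma expn1p2_mod n a b : (a = b %[mod p ^ n])%N ->
  ((1 + p ^ 2) ^ a = (1 + p ^ 2) ^ b %[mod p ^ n])%N.
Proof.
wlog ab : a b / (a <= b)%N.
  by move=> H; case: (leqP a b) => [|/ltnW] h e; [|symmetry]; apply: H.
move=> /esym/eqP; rewrite eqn_mod_dvd // => /dvdnP[c e].
rewrite -(subnK ab) e expnD mulnC [(c * _)%N]mulnC.
have [r ->] := expn1p2_mul p n c.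
rewrite -modnMmr.
have -> : (1 + p ^ (n + 2) * c + p ^ (n + 3) * r =
   p ^ n * (p ^ 2 * c + p ^ 3 * r) + 1)%N by rewrite !expnD; ring.
by rewrite [(p ^ n * _)%N]mulnC modnMDl modnMmr muln1.
Qed.

Lemma padic_pow_subproof s : compatible q (fun n => (1 + p ^ 2) ^ s n)%N.
Proof. by move=> n; apply: expn1p2_mod; apply: digits_compat. Qed.

(** The continuous homomorphism s |-> (1 + p^2)^s from Z_p to its units. *)
Definition upow s := padic_of (@padic_pow_subproof s).

Lemma digits_upow s n : upow s n = ((1 + p ^ 2) ^ s n %% p ^ n)%N.
Proof. by []. Qed.

Lemma digits_congr_upow s s' n : s n = s' n -> upow s n = upow s' n.
Proof. by rewrite !digits_upow => ->. Qed.

Lemma upowD s s' : upow (s + s') = upow s * upow s'.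
Proof.
apply: padic_eq => n; rewrite digitsM !digits_upow modnMm -expnD digitsD.
by apply: expn1p2_mod; rewrite modn_mod.
Qed.

Lemma upow_nat k : upow k%:R = ((1 + p ^ 2) ^ k)%:R.
Proof.
apply: padic_eq => n; rewrite digits_upow !digits_nat.
by apply: expn1p2_mod; rewrite modn_mod.
Qed.

Lemma upow0 : upow 0 = 1. Proof. by rewrite (upow_nat 0) expn0. Qed.

Lemma upow_mulVr s : upow s * upow (- s) = 1. Proof. by rewrite -upowD subrr upow0. Qed.

Lemma upow_pdvd n s : pdvd n s -> pdvd n (upow s - 1).
Proof.
move=> /digits_eq0P sn; apply/digits_eqP.
by rewrite -upow0; apply: digits_congr_upow; rewrite sn digits0.
Qed.

Lemma upow_linear k w :
  exists z, upow (p%:R ^+ k * w) = 1 + p%:R ^+ (k + 2) * w + p%:R ^+ (k + 3) * z.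
Proof.
have [y wy] := approx w 3; set j := w 3 in wy.
have [z1 e1] : pdvd (k + 3) (upow (p%:R ^+ (k + 3) * y) - 1).
  exact/upow_pdvd/pdvdX.
have {e1}e1 : upow (p%:R ^+ (k + 3) * y) = 1 + p%:R ^+ (k + 3) * z1.
  by rewrite -e1 addrC subrK.
have -> : p%:R ^+ k * w = (p ^ k * j)%:R + p%:R ^+ (k + 3) * y.
  by rewrite wy mulrDr mulrA -exprD natrM natrX.
rewrite upowD e1 upow_nat; have [r ->] := expn1p2_mul p k j.
rewrite !natrD !natrM !natrX wy.
exists (r%:R + z1 * (1 + p%:R ^+ (k + 2) * j%:R + p%:R ^+ (k + 3) * r%:R)
        - p%:R ^+ 2 * y).
by rewrite !exprD; ring.
Qed.

Hypothesis p_prime : prime p.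

(** The substitute for the p-adic exponential: (1 + p^2)^s - 1 is a unit times
    p^2 s. It follows from [upow_linear] after writing s = p^k w with w a
    unit. *)
Lemma upow_factor s : exists2 u, punit u & upow s = 1 + p%:R ^+ 2 * s * u.
Proof.
have [->|/eqP s0] := eqVneq s 0.
  by exists 1; [exact: punit1|rewrite upow0 mulr0 mul0r addr0].
have [k [w w_unit ->]] := padic_factor p_prime s0.
have [w' ww'] := w_unit.
have [z ->] := upow_linear k w.
exists (1 + p%:R * (z * w')).
  by apply: punitD => //; [exact: punit1|exact: (pdvdX 1)].
rewrite mulrDr mulr1; set X := _ * (_ * (z * w')).
have -> : X = p%:R ^+ (k + 3) * z * (w * w') by rewrite /X !exprD; ring.
by rewrite ww' mulr1 !exprD; ring.
Qed.

Lemma upow_inj s s' : upow s = upow s' -> s = s'.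
Proof.
move=> e; have : upow (s - s') = 1 by rewrite upowD e upow_mulVr.
have [u [u' uu'] ->] := upow_factor (s - s').
move/eqP; rewrite -subr_eq0 addrC addKr -mulrA => /eqP h0.
have h := padic_mul0 p_prime (@pX_neq0 q 2) h0.
apply/eqP; rewrite -subr_eq0; apply/eqP.
by rewrite -[LHS]mulr1 -uu' mulrA h mul0r.
Qed.

Lemma uquot_subproof r j : exists z, upow (r * j) - 1 = (upow r - 1) * z.
Proof.
have [u _ ->] := upow_factor (r * j); have [v [v' vv'] ->] := upow_factor r.
exists (j * u * v'); rewrite !(addrC 1) !addrK.
transitivity (p%:R ^+ 2 * r * j * u * (v * v')); last by ring.
by rewrite vv'; ring.
Qed.

(** The geometric sum of the (1 + p^2)^(r i) for 0 <= i < j, extended to p-adic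
    j. It is the factor by which x is multiplied in the j-th power of
    (r, x) in the semidirect product where s acts by (1 + p^2)^s. *)
Definition uquot r j : padic :=
  xget 0 [set z | upow (r * j) - 1 = (upow r - 1) * z].

Lemma uquotP r j : upow (r * j) - 1 = (upow r - 1) * uquot r j.
Proof. exact: (xgetPex 0 (uquot_subproof r j)). Qed.

Lemma upow_sub1_neq0 r : r <> 0 -> upow r - 1 <> 0.
Proof. by move=> r0 /eqP; rewrite subr_eq0 -upow0 => /eqP/upow_inj. Qed.

Section FixedBase.
Variable r : padic.
Hypothesis r0 : r <> 0.

Lemma uquot_eq j z : upow (r * j) - 1 = (upow r - 1) * z -> uquot r j = z.
Proof. by rewrite uquotP => /(padic_mulI p_prime (upow_sub1_neq0 r0)). Qed.

Lemma uquotD j j' : uquot r (j + j') = uquot r j * upow (r * j') + uquot r j'.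
Proof.
by apply: uquot_eq; rewrite [RHS]mulrDr mulrA -!uquotP mulrDr upowD; ring.
Qed.

Lemma uquot0 : uquot r 0 = 0.
Proof. by apply: uquot_eq; rewrite mulr0 upow0; ring. Qed.

Lemma uquot1 : uquot r 1 = 1.
Proof. by apply: uquot_eq; rewrite mulr1; ring. Qed.

Lemma uquotN j : uquot r (- j) = - uquot r j * upow (- (r * j)).
Proof.
have := uquotD j (- j); rewrite subrr uquot0 mulrN => /esym/eqP.
by rewrite addrC addr_eq0 => /eqP ->; rewrite mulNr.
Qed.

Lemma uquot_pdvd n j : pdvd n j -> pdvd n (uquot r j).
Proof.
move=> [y ->]; have [u _ e1] := upow_factor (r * (p%:R ^+ n * y)).
have [v [v' vv'] e2] := upow_factor r.
exists (y * u * v'); apply: uquot_eq; rewrite e1 e2 !(addrC 1) !addrK.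
transitivity (p%:R ^+ 2 * r * (p%:R ^+ n * y) * u * (v * v')); last by ring.
by rewrite vv'; ring.
Qed.

Lemma uquot_nat_congr n k : pdvd n (upow r - 1) -> pdvd n (uquot r k%:R - k%:R).
Proof.
move=> nE; elim: k => [|k IHk]; first by rewrite uquot0 subrr; apply: pdvd0.
rewrite -addn1 natrD uquotD uquot1 mulr1.
have -> : uquot r k%:R * upow r + 1 - (k%:R + 1) =
  uquot r k%:R * (upow r - 1) + (uquot r k%:R - k%:R) by ring.
by apply: pdvdD => //; apply: pdvdMl.
Qed.

(** A sum of j terms that are congruent to 1. *)
Lemma uquot_congr n j : pdvd n (upow r - 1) -> pdvd n (uquot r j - j).
Proof.
move=> nE; have [y {1 2}->] := approx j n; set k := j n.
rewrite uquotD; set z := p%:R ^+ n * y; have nz : pdvd n z by exact: pdvdX.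
have -> : uquot r k%:R * upow (r * z) + uquot r z - (k%:R + z) =
   (uquot r k%:R * (upow (r * z) - 1) + (uquot r k%:R - k%:R)) + (uquot r z - z) by ring.
apply: pdvdD; last by apply: pdvdB => //; apply: uquot_pdvd.
apply: pdvdD; last exact: uquot_nat_congr.
by apply: pdvdMl; apply: upow_pdvd; apply: pdvdMl.
Qed.

End FixedBase.
End Power.

(** * The topological groups *)

(** The triple (s, x, y) stands for the product t^s (x, y), where conjugation by
    t^s multiplies x by (1 + p^2)^s and y by (1 + p^2)^(mu s). The parameter mu
    is part of the type so that each mu has its own group structure. *)
Record semidirect (q : nat) (mu : padic q) :=
  Semidirect { tc : padic q; xc : padic q; yc : padic q }.
Arguments Semidirect {q} mu (tc xc yc)%_R.

HB.instance Definition _ q mu := gen_eqMixin (@semidirect q mu).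
HB.instance Definition _ q mu := gen_choiceMixin (@semidirect q mu).

Section Group.
Variables (q : nat) (mu : padic q).
Local Notation p := q.+2.
Local Notation padic := (padic q).
Local Notation G := (semidirect mu).
Local Notation elt := (Semidirect mu).
Implicit Types g h : G.

Lemma semidirect_eq g h : tc g = tc h -> xc g = xc h -> yc g = yc h -> g = h.
Proof. by case: g h => ? ? ? [? ? ?] /= -> -> ->. Qed.

Definition sd_mul g h := elt (tc g + tc h)
  (upow (tc h) * xc g + xc h) (upow (mu * tc h) * yc g + yc h).
Definition sd_one := elt 0 0 0.
Definition sd_inv g := elt (- tc g)
  (- (upow (- tc g) * xc g)) (- (upow (- (mu * tc g)) * yc g)).

Lemma sd_mulA : associative sd_mul.
Proof.
by move=> g h k; apply: semidirect_eq; rewrite /= ?mulrDr ?upowD; ring.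
Qed.
Lemma sd_mul1 : left_id sd_one sd_mul.
Proof. by move=> g; apply: semidirect_eq => /=; ring. Qed.
Lemma sd_mulr1 : right_id sd_one sd_mul.
Proof. by move=> g; apply: semidirect_eq => /=; rewrite ?mulr0 ?upow0; ring. Qed.
Lemma sd_mulV : left_inverse sd_one sd_inv sd_mul.
Proof.
move=> g; apply: semidirect_eq => /=; first by rewrite addNr.
  by rewrite mulrN mulrA upow_mulVr mul1r addNr.
by rewrite mulrN mulrA upow_mulVr mul1r addNr.
Qed.
Lemma sd_mulrV : right_inverse sd_one sd_inv sd_mul.
Proof.
by move=> g; apply: semidirect_eq => /=; rewrite ?subrr ?mulrN ?addrN.
Qed.

HB.instance Definition _ := isGroup.Build G sd_mulA sd_mul1 sd_mulr1 sd_mulV sd_mulrV.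

Definition gcongr n g h := [/\ tc g n = tc h n, xc g n = xc h n & yc g n = yc h n].

Lemma gcongr_refl n g : gcongr n g g. Proof. by []. Qed.
Lemma gcongr_sym n g h : gcongr n g h -> gcongr n h g.
Proof. by case=> a b c; split. Qed.
Lemma gcongr_trans n g h k : gcongr n g h -> gcongr n h k -> gcongr n g k.
Proof. by case=> a b c [d e f]; split; etransitivity; eauto. Qed.
Lemma gcongr_le m n g h : (m <= n)%N -> gcongr n g h -> gcongr m g h.
Proof.
by move=> mn [a b c]; split; rewrite -!(digits_modn _ mn) (a, b, c).
Qed.

Lemma tcM g h : tc (g * h)%g = tc g + tc h. Proof. by []. Qed.
Lemma xcM g h : xc (g * h)%g = upow (tc h) * xc g + xc h. Proof. by []. Qed.
Lemma ycM g h : yc (g * h)%g = upow (mu * tc h) * yc g + yc h. Proof. by []. Qed.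
Lemma tcV g : tc (g^-1)%g = - tc g. Proof. by []. Qed.
Lemma xcV g : xc (g^-1)%g = - (upow (- tc g) * xc g). Proof. by []. Qed.
Lemma ycV g : yc (g^-1)%g = - (upow (- (mu * tc g)) * yc g). Proof. by []. Qed.

Lemma gcongrM n g g' h h' : gcongr n g g' -> gcongr n h h' ->
  gcongr n (g * h)%g (g' * h')%g.
Proof.
by move=> [a b c] [d e f]; split; rewrite ?tcM ?xcM ?ycM;
  do ?[apply: digits_congrD | apply: digits_congrM | apply: digits_congr_upow].
Qed.

Lemma gcongrV n g h : gcongr n g h -> gcongr n (g^-1)%g (h^-1)%g.
Proof.
by move=> [a b c]; split; rewrite ?tcV ?xcV ?ycV;
  do ?[apply: digits_congrN | apply: digits_congrM | apply: digits_congr_upow].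
Qed.

Definition gnbhs g : set_system G := [set A | exists n, forall h, gcongr n g h -> A h].

HB.instance Definition _ := hasNbhs.Build G gnbhs.

Lemma gnbhs_filter g : ProperFilter (nbhs g).
Proof.
split; first by move=> [n /(_ g)]; apply.
split; first by exists 0%N.
- move=> A B [m Am] [n Bn]; exists (maxn m n) => h gh; split.
  + by apply: Am; apply: gcongr_le gh; apply: leq_maxl.
  + by apply: Bn; apply: gcongr_le gh; apply: leq_maxr.
- by move=> A B AB [n An]; exists n => h /An /AB.
Qed.

Lemma gnbhs_singleton g (A : set G) : nbhs g A -> A g.
Proof. by move=> [n]; apply. Qed.

Lemma gnbhs_nbhs g (A : set G) : nbhs g A -> nbhs g (nbhs^~ A).
Proof.
move=> [n An]; exists n => h gh; exists n => k hk.
by apply: An; apply: gcongr_trans hk.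
Qed.

HB.instance Definition _ := Nbhs_isNbhsTopological.Build G
  gnbhs_filter gnbhs_singleton gnbhs_nbhs.

Lemma nbhs_gcongr n g : nbhs g [set h | gcongr n g h].
Proof. by exists n. Qed.

Lemma sd_mul_continuous : continuous (fun x : G * G => (x.1 * x.2)%g).
Proof.
move=> [g h] A [n An]; exists ([set k | gcongr n g k], [set k | gcongr n h k]).
  by split; apply: nbhs_gcongr.
by move=> [k l] /= [gk hl]; apply: An; apply: gcongrM.
Qed.

Lemma sd_inv_continuous : continuous (fun x : G => (x^-1)%g).
Proof.
by move=> g A [n An]; exists n => h gh; apply: An; apply: gcongrV.
Qed.

HB.instance Definition _ := isTopologicalGroup.Build G
  sd_mul_continuous sd_inv_continuous.

End Group.

Section Topology.
Variables (q : nat) (mu : padic q).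
Local Notation p := q.+2.
Local Notation padic := (padic q).
Local Notation G := (semidirect mu).
Local Notation elt := (Semidirect mu).
Implicit Types g h : G.

Lemma gcongr_open n g : open [set h | gcongr n g h].
Proof.
by rewrite openE => h gh; exists n => k hk; apply: gcongr_trans hk.
Qed.

Lemma gcongr_clopen n g : clopen [set h | gcongr n g h].
Proof.
split; first exact: gcongr_open.
rewrite -openC openE => h gh; exists n => k hk gk; apply: gh.
by apply: gcongr_trans gk _; apply: gcongr_sym.
Qed.

Lemma gcongr_eq g h : (forall n, gcongr n g h) -> g = h.
Proof. by move=> gh; apply: semidirect_eq; apply: padic_eq => n; case: (gh n). Qed.

Lemma gcongr_neq g h : g <> h -> exists n, ~ gcongr n g h.
Proof.
move=> gh; apply: contrapT => /forallNP H; apply: gh; apply: gcongr_eq => n.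
by apply: contrapT; apply: H.
Qed.

Lemma semidirect_hausdorff : hausdorff_space G.
Proof.
move=> g h gh; apply: gcongr_eq => n.
have [k [gk hk]] := gh _ _ (nbhs_gcongr n g) (nbhs_gcongr n h).
by apply: gcongr_trans gk _; apply: gcongr_sym.
Qed.

Lemma semidirect_totally_disconnected : totally_disconnected [set: G].
Proof.
apply: zero_dimension_totally_disconnected => g h /eqP/gcongr_neq[n gh].
by exists [set k | gcongr n g k]; split => //; exact: gcongr_clopen.
Qed.

(** An ultrafilter contains exactly one of the finitely many residue classes
    modulo p^n, for each n, and these choices are compatible. *)
Lemma ultra_digits_cvg T (F : set_system T) (f : T -> padic) : UltraFilter F ->
  exists z : padic, forall n, F [set t | f t n = z n].
Proof.
move=> FU.
have ex_digit n : exists v, F [set t | f t n = v].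
  have : F [set t | (f t n < p ^ n)%N].
    by apply: filterS filterT => t _; apply: digits_ltn.
  elim: (p ^ n)%N => [|k IHk] Fk.
    by have [t] := filter_ex Fk; rewrite /= ltn0.
  have [?|Fnk] := in_ultra_setVsetC [set t | f t n = k] FU; first by exists k.
  apply: IHk; apply: filterS (filterI Fk Fnk) => t /= [].
  by rewrite ltnS leq_eqVlt => /orP[/eqP|].
have [v vP] := choice ex_digit.
have vmod n : (v n.+1 %% p ^ n)%N = v n.
  have [t [/= <- <-]] := filter_ex (filterI (vP n.+1) (vP n)).
  exact: digitsP.
by exists (Padic vmod).
Qed.

Lemma semidirect_compact : compact [set: G].
Proof.
rewrite compact_ultra => F FU _.
have [s Fs] := ultra_digits_cvg (@tc q mu) FU.
have [x Fx] := ultra_digits_cvg (@xc q mu) FU.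
have [y Fy] := ultra_digits_cvg (@yc q mu) FU.
exists (elt s x y); split=> // A [n An].
apply: filterS (filterI (Fs n) (filterI (Fx n) (Fy n))) => g /= [gs [gx gy]].
by apply: An; split.
Qed.

Lemma semidirect_profinite : profinite G.
Proof.
split; [exact: semidirect_compact|exact: semidirect_hausdorff|].
exact: semidirect_totally_disconnected.
Qed.

Lemma expg_t k : (elt 1 0 0 ^+ k = elt k%:R 0 0)%g.
Proof.
elim: k => [|k IHk]; first by rewrite expg0.
rewrite expgS IHk; apply: semidirect_eq; rewrite ?tcM ?xcM ?ycM /= ?mulr0 ?addr0 //.
by rewrite -addn1 natrD addrC.
Qed.

Lemma mulgV_elt s x y x' y' :
  (elt s x y * elt 0 x' y')%g = elt s (x + x') (y + y').
Proof.
by apply: semidirect_eq; rewrite ?tcM ?xcM ?ycM /= ?mulr0 ?upow0 ?mul1r ?addr0.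
Qed.

Lemma expg_V k x y : (elt 0 x y ^+ k = elt 0 (k%:R * x) (k%:R * y))%g.
Proof.
elim: k => [|k IHk]; first by rewrite expg0 !mul0r.
by rewrite expgSr IHk mulgV_elt -addn1 natrD !mulrDl !mul1r.
Qed.

(** Every element is approximated modulo p^n by t^a (1, 0)^b (0, 1)^c with a, b
    and c natural numbers. *)
Lemma semidirect_fg : top_finitely_generated G.
Proof.
exists [set elt 1 0 0; elt 0 1 0; elt 0 0 1]; split.
  by rewrite !finite_setU; repeat split; apply: finite_set1.
set S := [set _; _; _]; rewrite -subTset => g _ B [n Bn].
exists (elt (tc g n)%:R (xc g n)%:R (yc g n)%:R); split.
  move=> H [sH SH]; have /is_subgroupP[H1 HM HV] := sH.
  have -> : elt (tc g n)%:R (xc g n)%:R (yc g n)%:R =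
      (elt 1 0 0 ^+ tc g n * elt 0 1 0 ^+ xc g n * elt 0 0 1 ^+ yc g n)%g.
    by rewrite expg_t !expg_V !mulgV_elt !mulr1 !mulr0 !add0r !addr0.
  by apply: (HM); [apply: (HM)|]; apply: subgroup_exp => //; apply: SH;
    [left; left|left; right|right].
by apply: Bn; split; rewrite /= digits_nat digits_mod.
Qed.

End Topology.

(** * Lattices in the plane over the p-adic integers *)

Section Lattice.
Variable q : nat.
Local Notation p := q.+2.
Local Notation padic := (padic q).
Local Notation pX n := (p%:R ^+ n : padic).
Implicit Types (L : padic -> padic -> Prop) (x y : padic).

Record lattice L : Prop := Lattice {
  latticeD : forall x y x' y', L x y -> L x' y' -> L (x + x') (y + y') ;
  latticeZ : forall c x y, L x y -> L (c * x) (c * y) ;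
  lattice_open : exists N, forall x y, L (pX N * x) (pX N * y) }.

(** Stability of L under p^n diag (0, 1); this is how the action of the
    semidirect product constrains a lattice, see [lattice_diag]. *)
Definition ystable n L := forall x y, L x y -> L 0 (pX n * y).

Lemma lattice0 L : lattice L -> L 0 0.
Proof.
by case=> _ LZ [N LN]; have := LZ 0 _ _ (LN 0 0); rewrite !mul0r.
Qed.

Lemma latticeN L x y : lattice L -> L x y -> L (- x) (- y).
Proof. by move=> LL /(latticeZ LL (-1)); rewrite !mulN1r. Qed.

Lemma latticeB L x y x' y' : lattice L -> L x y -> L x' y' -> L (x - x') (y - y').
Proof. by move=> LL Lxy /(latticeN LL); apply: latticeD. Qed.

Lemma lattice_ge L : lattice L ->
  exists N, forall n x y, (N <= n)%N -> L (pX n * x) (pX n * y).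
Proof.
move=> [_ _ [N LN]]; exists N => n x y Nn.
by rewrite -(subnKC Nn) exprD -!mulrA; apply: LN.
Qed.

(** diag (a, b) is the scalar a plus diag (0, b - a). *)
Lemma lattice_diag n L a b x y : lattice L -> ystable n L ->
  pdvd n (b - a) -> L x y -> L (a * x) (b * y).
Proof.
move=> LL Ln [z ba] Lxy; have -> : a * x = a * x + z * 0 by ring.
have -> : b * y = a * y + z * (pX n * y).
  by rewrite -[b](subrK a) ba; ring.
by apply: (latticeD LL); apply: (latticeZ LL) => //; apply: Ln Lxy.
Qed.

Lemma ystable_le m n L : lattice L -> (m <= n)%N -> ystable m L -> ystable n L.
Proof.
move=> LL mn Lm x y /Lm /(latticeZ LL (pX (n - m))).
by rewrite mulr0 mulrA -exprD subnK.
Qed.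

Hypothesis p_prime : prime p.

(** Z_p is a discrete valuation ring. *)
Lemma ideal_eq_pX (S : padic -> Prop) N : (forall c x, S x -> S (c * x)) ->
  S (pX N) -> exists a, forall x, S x <-> pdvd a x.
Proof.
move=> SZ SN; have exS : exists n, `[< S (pX n) >] by exists N; apply/asboolP.
case: (ex_minnP exS) => a /asboolP Sa min; exists a => x.
split=> [Sx|[y ->]]; last by rewrite mulrC; apply: SZ.
have [->|/eqP x0] := eqVneq x 0; first exact: pdvd0.
have [k [w [w' ww'] xE]] := padic_factor p_prime x0.
rewrite xE; apply: (pdvd_le _ (pdvdX k w)); apply: min; apply/asboolP.
have -> : pX k = w' * x by rewrite xE mulrCA [w' * w]mulrC ww' mulr1.
exact: SZ.
Qed.

End Lattice.

(** * Coordinates of open subgroups *)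

Section OpenSubgroups.
Variables (q : nat) (mu : padic q).
Local Notation p := q.+2.
Local Notation padic := (padic q).
Local Notation G := (semidirect mu).
Local Notation elt := (Semidirect mu).
Local Notation pX n := (p%:R ^+ n : padic).
Implicit Types (g h : G) (L : padic -> padic -> Prop) (H : set G).

Lemma mulg_V g x y : (g * elt 0 x y)%g = elt (tc g) (xc g + x) (yc g + y).
Proof. by case: g => ? ? ?; apply: mulgV_elt. Qed.

Lemma gcongr_near1 N s x y : gcongr N 1%g (elt (pX N * s) (pX N * x) (pX N * y)).
Proof.
have z w : (0 : padic) N = (pX N * w) N.
  by rewrite digits0; apply/esym/digits_eq0P/pdvdX.
by split; apply: z.
Qed.

Lemma near1_exists N h : gcongr N 1%g h ->
  exists s x y, h = elt (pX N * s) (pX N * x) (pX N * y).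
Proof.
case=> ht hx hy.
have z (w : padic) : (0 : padic) N = w N -> exists a, w = pX N * a.
  by rewrite digits0 => /esym/digits_eq0P.
have [[s es] [x ex] [y ey]] := And3 (z _ ht) (z _ hx) (z _ hy).
by exists s, x, y; apply: semidirect_eq.
Qed.

Lemma open_subgroup_near1 H : open H -> is_subgroup H ->
  exists N, forall h, gcongr N 1%g h -> H h.
Proof.
by rewrite openE => oH /is_subgroupP[/oH[N HN] _ _]; exists N.
Qed.

Lemma near1_open_subgroup H : is_subgroup H ->
  (exists N, forall h, gcongr N 1%g h -> H h) -> open H.
Proof.
move=> /is_subgroupP[_ HM _] [N HN]; rewrite openE => g Hg; exists N => h gh.
rewrite -[h](mulVKg g); apply: HM => //; apply: HN.
rewrite -(mulVg g); exact: gcongrM (gcongr_refl _ _) gh.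
Qed.

Hypothesis p_prime : prime p.
Hypothesis mu_val : pval1 mu.

Lemma mu_neq0 : mu <> 0.
Proof.
have [nu nuU ->] := mu_val.
have := @pX_neq0 q 1; rewrite expr1 => p0 /(padic_mul0 p_prime p0) nu0.
by move: nuU => [v]; rewrite nu0 mul0r => /esym/eqP; rewrite oner_eq0.
Qed.

Lemma mupX_neq0 m : mu * pX m <> 0.
Proof. by move=> /(padic_mul0 p_prime mu_neq0); apply: pX_neq0. Qed.

Lemma upow_sub_pdvd m j : pdvd (m + 2) (upow (mu * pX m * j) - upow (pX m * j)).
Proof.
have [u _ ->] := upow_factor p_prime (mu * pX m * j).
have [v _ ->] := upow_factor p_prime (pX m * j).
by exists (j * (mu * u - v)); rewrite exprD; ring.
Qed.

(** As p divides mu, (1 + p^2)^(mu p^m) is 1 modulo p^(m+3), while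
    (1 + p^2)^(p^m) is 1 plus p^(m+2) times a unit. *)
Lemma upow_sub_unit m : exists2 u, punit u &
  upow (mu * pX m) - upow (pX m) = pX (m + 2) * u.
Proof.
have [u _ ->] := upow_factor p_prime (mu * pX m).
have [v vU ->] := upow_factor p_prime (pX m).
exists (- v + mu * u); last by rewrite exprD; ring.
apply: punitD => //; first exact: punitN.
by have [nu _ ->] := mu_val; exists (nu * u); rewrite expr1 mulrA.
Qed.

(** For a lattice L stable under conjugation by (p^m, v1, v2), this is the closed
    subgroup generated by (p^m, v1, v2) and L: over p^m j it consists of the
    coset of L through the j-th power of (p^m, v1, v2). *)
Definition coord_subgroup m L v1 v2 : set G := [set g | exists2 j, tc g = pX m * j &
  L (xc g - uquot (pX m) j * v1) (yc g - uquot (mu * pX m) j * v2)].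

Local Notation pX0 m := (@pX_neq0 q m).
Local Notation mp0 m := (@mupX_neq0 m).

Section Sub.
Variables (m : nat) (L : padic -> padic -> Prop) (v1 v2 : padic).
Hypothesis (LL : lattice L) (Ls : ystable (m + 2) L).

Lemma lattice_act j x y : L x y -> L (upow (pX m * j) * x) (upow (mu * pX m * j) * y).
Proof. by apply: lattice_diag Ls _ => //; apply: upow_sub_pdvd. Qed.

Lemma coord_subgroup_is_subgroup : is_subgroup (coord_subgroup m L v1 v2).
Proof.
apply/is_subgroupP; split.
- exists 0; rewrite ?mulr0 // (uquot0 p_prime (pX0 m)) (uquot0 p_prime (mp0 m)).
  by rewrite !mul0r subr0; apply: lattice0.
- move=> g h [j gj Lg] [k hk Lh]; exists (j + k).
    by rewrite tcM gj hk mulrDr.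
  have := latticeD LL (lattice_act k Lg) Lh.
  rewrite xcM ycM hk (uquotD p_prime (pX0 m)) (uquotD p_prime (mp0 m)) mulrA.
  by congr L; ring.
- move=> g [j gj Lg]; exists (- j); first by rewrite tcV gj mulrN.
  have := latticeN LL (lattice_act (- j) Lg).
  rewrite xcV ycV gj (uquotN p_prime (pX0 m)) (uquotN p_prime (mp0 m)) !mulrN mulrA.
  by congr L; ring.
Qed.

Lemma coord_subgroup_near1 :
  exists N, forall h, gcongr N 1%g h -> coord_subgroup m L v1 v2 h.
Proof.
have [N LN] := lattice_ge LL; exists (N + m)%N => h /near1_exists[s [x [y ->]]].
have [a ea] : pdvd N (uquot (pX m) (pX N * s)).
  by apply: uquot_pdvd; [|exact: pX_neq0|exact: pdvdX].
have [b eb] : pdvd N (uquot (mu * pX m) (pX N * s)).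
  by apply: uquot_pdvd; [|exact: mupX_neq0|exact: pdvdX].
exists (pX N * s); first by rewrite /= addnC exprD mulrA.
have := LN N (pX m * x - a * v1) (pX m * y - b * v2) (leqnn N).
by rewrite /= ea eb exprD; congr L; ring.
Qed.

Lemma coord_subgroup_open : open (coord_subgroup m L v1 v2).
Proof.
apply: near1_open_subgroup; first exact: coord_subgroup_is_subgroup.
exact: coord_subgroup_near1.
Qed.

Lemma coord_subgroup_base : coord_subgroup m L v1 v2 (elt (pX m) v1 v2).
Proof.
exists 1; first by rewrite mulr1.
rewrite /= (uquot1 p_prime (pX0 m)) (uquot1 p_prime (mp0 m)) !mul1r !subrr.
exact: lattice0.
Qed.

Lemma coord_subgroup_fiber0 x y : coord_subgroup m L v1 v2 (elt 0 x y) <-> L x y.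
Proof.
split=> [[j /esym/(padic_mul0 p_prime (pX0 m)) -> /=]|Lxy].
  by rewrite (uquot0 p_prime (pX0 m)) (uquot0 p_prime (mp0 m)) !mul0r !subr0.
exists 0; first by rewrite mulr0.
by rewrite /= (uquot0 p_prime (pX0 m)) (uquot0 p_prime (mp0 m)) !mul0r !subr0.
Qed.

End Sub.

Definition fiber0 H x y := H (elt 0 x y).

Section Structure.
Variable H : set G.
Hypothesis (oH : open H) (sH : is_subgroup H).

Lemma fiber0_lattice : lattice (fiber0 H).
Proof.
have [N HN] := open_subgroup_near1 oH sH; have /is_subgroupP[H1 HM HV] := sH.
have LD x y x' y' : fiber0 H x y -> fiber0 H x' y' -> fiber0 H (x + x') (y + y').
  by move=> h h'; rewrite /fiber0 -mulgV_elt; apply: HM.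
have LN x y : fiber0 H (pX N * x) (pX N * y).
  by apply: HN; have := gcongr_near1 N 0 x y; rewrite mulr0.
split=> //; last by exists N.
move=> c x y Hxy; have [z ->] := approx c N.
rewrite !mulrDl -!mulrA; apply: LD; last exact: LN.
by rewrite /fiber0 -expg_V; apply: subgroup_exp.
Qed.

Lemma expg_base m v1 v2 k : (elt (pX m) v1 v2 ^+ k)%g =
  elt (pX m * k%:R) (uquot (pX m) k%:R * v1) (uquot (mu * pX m) k%:R * v2).
Proof.
elim: k => [|k IHk].
  rewrite expg0 mulr0 (uquot0 p_prime (pX0 m)) (uquot0 p_prime (mp0 m)).
  by apply: semidirect_eq; rewrite /= ?mul0r.
rewrite expgSr IHk -(addn1 k) natrD (uquotD p_prime (pX0 m)) (uquotD p_prime (mp0 m)).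
rewrite (uquot1 p_prime (pX0 m)) (uquot1 p_prime (mp0 m)) !mulr1.
by apply: semidirect_eq; rewrite ?tcM ?xcM ?ycM /=; ring.
Qed.

(** The j-th power of (p^m, v1, v2), for p-adic j, differs from a natural power
    by an element close to 1. *)
Lemma base_padic_exp m v1 v2 j : H (elt (pX m) v1 v2) ->
  H (elt (pX m * j) (uquot (pX m) j * v1) (uquot (mu * pX m) j * v2)).
Proof.
have [N HN] := open_subgroup_near1 oH sH; have /is_subgroupP[H1 HM HV] := sH.
move=> Hv; have [z ->] := approx j N; set k := j N.
have [a ea] : pdvd N (uquot (pX m) (pX N * z)).
  by apply: uquot_pdvd; [|exact: pX_neq0|exact: pdvdX].
have [b eb] : pdvd N (uquot (mu * pX m) (pX N * z)).
  by apply: uquot_pdvd; [|exact: mupX_neq0|exact: pdvdX].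
have := HM _ _ (subgroup_exp k sH Hv)
  (HN _ (gcongr_near1 N (pX m * z) (a * v1) (b * v2))).
rewrite expg_base (uquotD p_prime (pX0 m)) (uquotD p_prime (mp0 m)) ea eb.
have es : pX N * (pX m * z) = pX m * (pX N * z) by ring.
by congr H; apply: semidirect_eq;
  rewrite ?tcM ?xcM ?ycM /= es ?[mu * (_ * _)]mulrA; ring.
Qed.

(** Conjugation by (p^m, v1, v2) acts on the lattice by diag (a, b) where b - a
    is p^(m+2) times a unit. *)
Lemma fiber0_ystable m v1 v2 : H (elt (pX m) v1 v2) -> ystable (m + 2) (fiber0 H).
Proof.
have /is_subgroupP[H1 HM HV] := sH; have LL := fiber0_lattice.
move=> Hv x y Lxy; have [u [u' uu'] eu] := upow_sub_unit m.
have Lconj : fiber0 H (upow (pX m) * x) (upow (mu * pX m) * y).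
  have := HM _ _ (HV _ Hv) (HM _ _ Lxy Hv).
  rewrite /fiber0; congr H.
  apply: semidirect_eq; rewrite !(tcM, xcM, ycM, tcV, xcV, ycV) /=.
  - by ring.
  - by rewrite add0r mulrN mulrA upow_mulVr; ring.
  - by rewrite add0r mulrN mulrA upow_mulVr; ring.
have := latticeZ LL u' (latticeB LL Lconj (latticeZ LL (upow (pX m)) Lxy)).
rewrite subrr mulr0 -mulrBl eu; congr (fiber0 H 0).
by rewrite -[RHS]mulr1 -uu'; ring.
Qed.

Lemma open_subgroup_of_base m v1 v2 : (forall g, H g -> pdvd m (tc g)) ->
  H (elt (pX m) v1 v2) -> H = coord_subgroup m (fiber0 H) v1 v2.
Proof.
have /is_subgroupP[H1 HM HV] := sH.
move=> Hm Hv; apply/seteqP; split=> g.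
  move=> Hg; have [j gj] := Hm _ Hg; exists j => //.
  have := HM _ _ (HV _ (base_padic_exp j Hv)) Hg.
  set c := elt (pX m * j) _ _.
  have {1}-> : g = (c * elt 0 (xc g - xc c) (yc g - yc c))%g.
    by rewrite mulg_V; apply: semidirect_eq; rewrite //= addrC subrK.
  by rewrite mulKg.
move=> [j gj Lg]; have := HM _ _ (base_padic_exp j Hv) Lg; rewrite mulg_V /=.
by congr H; apply: semidirect_eq; rewrite //= addrC subrK.
Qed.

Lemma tc_exp g k : tc (g ^+ k)%g = k%:R * tc g.
Proof.
elim: k => [|k IHk]; first by rewrite expg0 mul0r.
by rewrite expgSr tcM IHk -(addn1 k) natrD mulrDl mul1r.
Qed.

(** The projection of H to Z_p is an ideal, because H is closed under p-adic
    powers up to elements close to 1; p^m is its generator. *)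
Lemma open_subgroup_base : exists m v1 v2,
  H (elt (pX m) v1 v2) /\ forall g, H g -> pdvd m (tc g).
Proof.
have [N HN] := open_subgroup_near1 oH sH; have /is_subgroupP[H1 HM HV] := sH.
pose S n := `[< exists v1 v2, H (elt (pX n) v1 v2) >].
have exS : exists n, S n.
  exists N; apply/asboolP; exists (pX N * 0), (pX N * 0); apply: HN.
  by have := gcongr_near1 N 1 0 0; rewrite mulr1.
case: (ex_minnP exS) => m /asboolP[v1 [v2 Hv]] min; exists m, v1, v2; split=> // g Hg.
have [->|/eqP g0] := eqVneq (tc g) 0; first exact: pdvd0.
have [k [w [w' ww'] gE]] := padic_factor p_prime g0.
rewrite gE; apply: (pdvd_le _ (pdvdX k w)); apply: min; apply/asboolP.
have [z w'E] := approx w' N.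
have := HM _ _ (subgroup_exp (w' N) sH Hg) (HN _ (gcongr_near1 N (z * tc g) 0 0)).
set h := (_ * _)%g => Hh; exists (xc h), (yc h).
suff <- : tc h = pX k by case: (h) Hh.
rewrite tcM tc_exp /= mulrA -mulrDl -w'E gE.
by rewrite mulrCA [w' * w]mulrC ww' mulr1.
Qed.

Lemma open_subgroup_coord : exists m v1 v2,
  H = coord_subgroup m (fiber0 H) v1 v2 /\ ystable (m + 2) (fiber0 H).
Proof.
have [m [v1 [v2 [Hv Hm]]]] := open_subgroup_base; exists m, v1, v2; split.
  exact: open_subgroup_of_base.
exact: fiber0_ystable Hv.
Qed.

End Structure.

Lemma pdvd_pX m n : pdvd m (pX n) -> (m <= n)%N.
Proof.
move=> /digits_eq0P; rewrite -natrX digits_nat => e; rewrite leqNgt.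
by apply/negP => nm; move: e; rewrite modn_small ?ltn_exp2l // => /eqP; rewrite expn_eq0.
Qed.

Lemma coord_subgroup_eqP m L v1 v2 m' L' v1' v2' :
  lattice L -> ystable (m + 2) L -> lattice L' -> ystable (m' + 2) L' ->
  coord_subgroup m L v1 v2 = coord_subgroup m' L' v1' v2' <->
  [/\ m = m', L = L' & L (v1 - v1') (v2 - v2')].
Proof.
move=> LL Ls LL' Ls'; split=> [e|[em eL Lv]].
  have mm' : m = m'.
    apply/eqP; rewrite eqn_leq; apply/andP; split; apply: pdvd_pX.
      by have := coord_subgroup_base m' v1' v2' LL'; rewrite -e => -[j /= -> _]; exists j.
    by have := coord_subgroup_base m v1 v2 LL; rewrite e => -[j /= -> _]; exists j.
  subst m'; have eL : L = L'.
    apply/funext => x; apply/funext => y; apply/propext.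
    by rewrite -(coord_subgroup_fiber0 m L v1 v2) e coord_subgroup_fiber0.
  subst L'; split=> //.
  have := coord_subgroup_base m v1 v2 LL; rewrite e => -[j /= ej].
  have -> : j = 1 by apply: (@pX_mulI q m); rewrite -ej mulr1.
  by rewrite (uquot1 p_prime (pX0 m)) (uquot1 p_prime (mp0 m)) !mul1r.
subst m' L'.
have eL : fiber0 (coord_subgroup m L v1' v2') = L.
  apply/funext => x; apply/funext => y; apply/propext.
  by rewrite /fiber0 coord_subgroup_fiber0.
rewrite -{1}eL; apply: esym; apply: open_subgroup_of_base.
- exact: coord_subgroup_open.
- exact: coord_subgroup_is_subgroup.
- by move=> g [j -> _]; exact: pdvdX.
exists 1; first by rewrite mulr1.
by rewrite /= (uquot1 p_prime (pX0 m)) (uquot1 p_prime (mp0 m)) !mul1r.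
Qed.

(** Hermite normal form: if L projects onto p^a Z_p and meets the y-axis in
    p^b Z_p, then the (i, j, k) with i < p^m, j < p^a and k < p^b represent the
    left cosets. *)
Lemma coord_subgroup_index m a b L v1 v2 : lattice L -> ystable (m + 2) L ->
  (forall x, (exists y, L x y) <-> pdvd a x) -> (forall y, L 0 y <-> pdvd b y) ->
  has_index (coord_subgroup m L v1 v2) (p ^ (m + a + b)).
Proof.
move=> LL Ls La Lb; set H := coord_subgroup _ _ _ _.
have sH : is_subgroup H by exact: coord_subgroup_is_subgroup.
have oH : open H by exact: coord_subgroup_open.
pose T : finType := ('I_(p ^ m) * 'I_(p ^ a) * 'I_(p ^ b))%type.
pose rep (t : T) := elt t.1.1%:R t.1.2%:R t.2%:R.
have cardT : #|T| = (p ^ (m + a + b))%N by rewrite !card_prod !card_ord !expnD.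
have ord_eq n (i i' : 'I_(p ^ n)) : pdvd n (i'%:R - i%:R : padic) -> i = i'.
  by move=> /digits_eqP; rewrite !digits_nat !modn_small // => /val_inj.
pose F t := left_coset (rep t) H.
have F_inj : injective F.
  move=> [[i j] k] [[i' j'] k'] /(left_coset_eqP _ _ sH) Hr.
  have ei : i = i'.
    by apply: ord_eq; move: Hr => [z]; rewrite tcM tcV /= addrC => -> _; exact: pdvdX.
  subst i'; have : L (j'%:R - j%:R) (k'%:R - k%:R).
    apply/(coord_subgroup_fiber0 m L v1 v2); move: Hr; congr H.
    have -> : rep (i, j', k') = (rep (i, j, k) * elt 0 (j'%:R - j%:R) (k'%:R - k%:R))%g.
      by rewrite mulg_V; apply: semidirect_eq; rewrite //= addrC subrK.
    by rewrite mulKg.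
  move=> Lr; have ej : j = j' by apply: ord_eq; apply/La; exists (k'%:R - k%:R).
  subst j'; move: Lr; rewrite subrr => /Lb/ord_eq ek.
  by subst k'.
have F_surj g : exists t, left_coset g H = F t.
  have [z ez] := approx (tc g) m; set i := tc g m in ez.
  have Hz := base_padic_exp oH sH (- z) (coord_subgroup_base m v1 v2 LL).
  set h0 := elt _ _ _ in Hz; set g0 := (g * h0)%g.
  have tg0 : tc g0 = i%:R by rewrite tcM ez /=; ring.
  have [x' ex] := approx (xc g0) a; set j := xc g0 a in ex.
  have [y1 Ly1] : exists y, L (pX a * x') y by apply/La; exact: pdvdX.
  have [w ey] := approx (yc g0 - y1) b; set k := _ b in ey.
  have Lw : L 0 (pX b * w) by apply/Lb; exact: pdvdX.
  have im : (i < p ^ m)%N by exact: digits_ltn.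
  have ja : (j < p ^ a)%N by exact: digits_ltn.
  have kb : (k < p ^ b)%N by exact: digits_ltn.
  exists (Ordinal im, Ordinal ja, Ordinal kb); apply/left_coset_eqP => //.
  have /is_subgroupP[_ HM _] := sH.
  have := latticeN LL (latticeD LL Ly1 Lw) => /(coord_subgroup_fiber0 m L v1 v2) Hl.
  have := HM _ _ Hz Hl; congr H.
  rewrite -[LHS](mulKg g); congr (_ * _)%g; rewrite mulgA mulg_V -/g0.
  move: (g0) tg0 ex ey => g1 tg1 ex ey; apply: semidirect_eq; rewrite //= ?addr0.
    by rewrite ex addrK.
  by rewrite opprD addrA ey addrK.
rewrite /has_index.
have -> : [set left_coset x H | x in [set: G]] =
    (F \o enum_val) @` [set: 'I_#|T|].
  apply/seteqP; split=> _ [x _ <-] /=; last by exists (rep (enum_val x)).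
  by have [t ->] := F_surj x; exists (enum_rank t); rewrite //= enum_rankK.
rewrite -cardT (card_eqr card_II).
by apply: inj_card_eq => t t' _ _ /F_inj/enum_val_inj.
Qed.

End OpenSubgroups.

Section LatticeIndex.
Variable q : nat.
Local Notation p := q.+2.
Local Notation padic := (padic q).
Local Notation pX n := (p%:R ^+ n : padic).
Implicit Types (L : padic -> padic -> Prop).

(** The value n of p^m [Z_p^2 : L], in terms of the Hermite normal form of L. *)
Definition lattice_index m L n := exists a b,
  [/\ forall x, (exists y, L x y) <-> pdvd a x, forall y, L 0 y <-> pdvd b y
    & n = (p ^ (m + a + b))%N].

Hypothesis p_prime : prime p.

Lemma lattice_index_exists m L : lattice L -> exists e, lattice_index m L (p ^ e).
Proof.
move=> LL; have [N LN] := lattice_open LL.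
have [a La] : exists a, forall x, (exists y, L x y) <-> pdvd a x.
  apply: (ideal_eq_pX p_prime (N := N)) => [c x [y Lxy]|].
    by exists (c * y); apply: latticeZ.
  by exists (pX N * 0); have := LN 1 0; rewrite mulr1.
have [b Lb] : exists b, forall y, L 0 y <-> pdvd b y.
  apply: (ideal_eq_pX p_prime (N := N)) => [c y /(latticeZ LL c)|].
    by rewrite mulr0.
  by have := LN 0 1; rewrite mulr0 mulr1.
by exists (m + a + b)%N, a, b.
Qed.

Lemma has_index_coord_subgroupP mu m L v1 v2 n : pval1 mu ->
  lattice L -> ystable (m + 2) L ->
  has_index (@coord_subgroup q mu m L v1 v2) n <-> lattice_index m L n.
Proof.
move=> mu_val LL Ls; split=> [Hn|[a [b [La Lb ->]]]]; last exact: coord_subgroup_index.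
have [e [a [b [La Lb e_eq]]]] := lattice_index_exists m LL.
exists a, b; split=> //; apply: has_index_uniq Hn _; exact: coord_subgroup_index.
Qed.

End LatticeIndex.

(** * Normal subgroups *)

Section Normal.
Variables (q : nat) (mu : padic q).
Local Notation p := q.+2.
Local Notation padic := (padic q).
Local Notation G := (semidirect mu).
Local Notation elt := (Semidirect mu).
Local Notation pX n := (p%:R ^+ n : padic).
Implicit Types (g h : G) (L : padic -> padic -> Prop) (H : set G).

Lemma conjg_semidirect h g : (h ^ g)%g = elt (tc h)
  (upow (tc g) * xc h - (upow (tc h) - 1) * xc g)
  (upow (mu * tc g) * yc h - (upow (mu * tc h) - 1) * yc g).
Proof.
rewrite /conjg; apply: semidirect_eq; rewrite !(tcM, xcM, ycM, tcV, xcV, ycV) /=.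
- by ring.
- rewrite upowD; transitivity (upow (tc g) * xc h + xc g -
    (upow (tc g) * upow (- tc g)) * (upow (tc h) * xc g)); first by ring.
  by rewrite upow_mulVr; ring.
- rewrite mulrDr upowD; transitivity (upow (mu * tc g) * yc h + yc g -
    (upow (mu * tc g) * upow (- (mu * tc g))) * (upow (mu * tc h) * yc g)); first by ring.
  by rewrite upow_mulVr; ring.
Qed.

Hypothesis p_prime : prime p.
Hypothesis mu_val : pval1 mu.
Local Notation mp0 m := (@mupX_neq0 q mu p_prime mu_val m).
Local Notation pX0 m := (@pX_neq0 q m).

Definition normal_lattice m L :=
  [/\ ystable 2 L, forall x, L (pX (m + 2) * x) 0 & forall y, L 0 (pX (m + 3) * y)].

Lemma normal_lattice_ystable m L : lattice L -> normal_lattice m L -> ystable (m + 2) L.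
Proof. by move=> LL [L2 _ _]; apply: (ystable_le LL _ L2); apply: leq_addl. Qed.

Lemma upow_sub1_pdvd2 (s : padic) : pdvd 2 (upow s - 1).
Proof. by have [u _ ->] := upow_factor p_prime s; exists (s * u); ring. Qed.

Lemma upow_sub1_factor (s : padic) : exists2 u, punit u & upow s - 1 = pX 2 * s * u.
Proof. by have [u uU ->] := upow_factor p_prime s; exists u => //; ring. Qed.

(** Conjugating the lattice by t, the base element by the plane, and the base
    element by t gives the three kinds of conditions on the left. Conversely,
    conjugating (p^m j, w) by (s, x, y) moves w within its coset of L by three
    terms, one for each kind. *)
Lemma coord_subgroup_normalP m L v1 v2 : lattice L -> ystable (m + 2) L ->
  is_normal_subgroup (@coord_subgroup q mu m L v1 v2) <->
  normal_lattice m L /\ L ((upow 1 - 1) * v1) ((upow mu - 1) * v2).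
Proof.
move=> LL Ls; set H := coord_subgroup _ _ _ _.
have sH : is_subgroup H by exact: coord_subgroup_is_subgroup.
have Hv : H (elt (pX m) v1 v2) by exact: coord_subgroup_base.
have [nu [nu' nuV] mu_eq] := mu_val.
have fib x y : H (elt 0 x y) <-> L x y by exact: coord_subgroup_fiber0.
split=> [[_ nH]|[[L2 Lx Ly] Lv]].
  have L2 : ystable 2 L.
    move=> x y /fib Hxy; have := nH _ (elt 1 0 0) Hxy.
    rewrite conjg_semidirect /= !mulr1 !mulr0 !subr0 => /fib Lc.
    have [u [u' uV] eu] := upow_sub_unit p_prime mu_val 0.
    have := latticeZ LL u' (latticeB LL Lc (latticeZ LL (upow 1) ((fib x y).1 Hxy))).
    move: eu; rewrite expr0 mulr1 subrr mulr0 -mulrBl => ->; congr L.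
    by rewrite -[RHS]mulr1 -uV; ring.
  have Hdiff x y : H (elt (pX m) x y) -> L (x - v1) (y - v2).
    move=> [j /= ej]; have -> : j = 1 by apply: (@pX_mulI q m); rewrite -ej mulr1.
    by rewrite (uquot1 p_prime (pX0 m)) (uquot1 p_prime (mp0 m)) !mul1r.
  have Lxy x y : L ((upow (pX m) - 1) * x) ((upow (mu * pX m) - 1) * y).
    have := nH _ (elt 0 (- x) (- y)) Hv.
    rewrite conjg_semidirect /= !mulr0 upow0 => /Hdiff; congr L; ring.
  split; first split=> //.
  - move=> x; have [u [u' uV] eu] := upow_sub1_factor (pX m).
    have := Lxy (u' * x) 0; rewrite mulr0 eu; congr L.
    by rewrite addnC exprD -[RHS]mulr1 -uV; ring.
  - move=> y; have [u [u' uV] eu] := upow_sub1_factor (mu * pX m).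
    have := Lxy 0 (u' * (nu' * y)); rewrite mulr0 eu mu_eq; congr L.
    transitivity (pX (m + 3) * y * (u * u') * (nu * nu')); last by rewrite uV nuV !mulr1.
    by rewrite exprD; ring.
  have := nH _ (elt 1 0 0) Hv.
  by rewrite conjg_semidirect /= !mulr1 !mulr0 !subr0 => /Hdiff; congr L; ring.
split=> // h g [j hj Lh]; exists j; first by rewrite conjg_semidirect.
rewrite conjg_semidirect /= hj.
set Q1j := uquot (pX m) j; set Q2j := uquot _ j.
have [u _ eu] := upow_sub1_factor (pX m * j).
have [w _ ew] := upow_sub1_factor (mu * (pX m * j)).
have L1 : L (upow (tc g) * (xc h - Q1j * v1)) (upow (mu * tc g) * (yc h - Q2j * v2)).
  apply: (lattice_diag LL L2) => //.
  have -> : upow (mu * tc g) - upow (tc g) =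
    (upow (mu * tc g) - 1) - (upow (tc g) - 1) by ring.
  by apply: pdvdB; apply: upow_sub1_pdvd2.
have L3 : L ((upow (pX m * j) - 1) * xc g) ((upow (mu * (pX m * j)) - 1) * yc g).
  have ew' : upow (mu * (pX m * j)) - 1 = pX (m + 3) * (nu * j * w).
    by rewrite ew mu_eq exprD; ring.
  have := latticeD LL (Lx (j * u * xc g)) (Ly (nu * j * w * yc g)).
  by rewrite eu ew' addr0 add0r !exprD; congr L; ring.
(* u^s - 1 is u - 1 times a factor congruent to s modulo p^2, in both
   coordinates, so that the condition on (v1, v2) propagates from t to t^s. *)
have L4 : L ((upow (tc g) - 1) * (Q1j * v1)) ((upow (mu * tc g) - 1) * (Q2j * v2)).
  have Qc (r i : padic) : r <> 0 -> pdvd 2 (uquot r i - i).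
    by move=> r0; apply: (uquot_congr p_prime r0); apply: upow_sub1_pdvd2.
  have mu0 := mu_neq0 p_prime mu_val.
  have one0 : (1 : padic) <> 0 by apply/eqP; exact: oner_neq0.
  have dQ : pdvd 2 (uquot mu (tc g) * Q2j - uquot 1 (tc g) * Q1j).
    have -> : uquot mu (tc g) * Q2j - uquot 1 (tc g) * Q1j =
       (uquot mu (tc g) - tc g) * Q2j - (uquot 1 (tc g) - tc g) * Q1j +
       tc g * ((Q2j - j) - (Q1j - j)) by ring.
    apply: pdvdD; first by apply: pdvdB; apply: pdvdMr; apply: Qc.
    by apply: pdvdMl; apply: pdvdB; apply: Qc; [exact: mupX_neq0|exact: pX_neq0].
  have := lattice_diag LL L2 dQ Lv.
  rewrite (uquotP p_prime mu) -{3}[tc g]mul1r (uquotP p_prime 1); congr L; ring.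
have := latticeB LL (latticeD LL L1 L4) L3; congr L; ring.
Qed.

End Normal.

(** * Equality of the zeta functions *)

Section Isospectral.
Variable q : nat.
Local Notation p := q.+2.
Local Notation padic := (padic q).
Local Notation pX n := (p%:R ^+ n : padic).
Implicit Types (L : padic -> padic -> Prop) (mu : padic).
Hypothesis p_prime : prime p.

Lemma semidirect_pro_p mu : pval1 mu -> pro_p_group (semidirect mu) p.
Proof.
move=> mu_val; split; first exact: semidirect_profinite.
move=> N oN [sN _].
have [m [v1 [v2 [NE Ls]]]] := open_subgroup_coord p_prime mu_val oN sN.
have LL := fiber0_lattice oN sN.
have [e Le] := lattice_index_exists p_prime m LL.
exists e; rewrite NE.
exact/(has_index_coord_subgroupP p_prime v1 v2 _ mu_val LL Ls).
Qed.

Let coord := (nat * (padic -> padic -> Prop) * padic * padic)%type.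

(** The factor k on the second coordinate carries the correction needed to match
    normal subgroups. *)
Let subgroup_of mu (k : padic) (d : coord) : set (semidirect mu) :=
  coord_subgroup d.1.1.1 d.1.1.2 d.1.2 (k * d.2).

Lemma num_subgroups_indep mu mu' n : pval1 mu -> pval1 mu' ->
  num_subgroups (semidirect mu) n = num_subgroups (semidirect mu') n.
Proof.
pose D : set coord := [set d | [/\ lattice d.1.1.2, ystable (d.1.1.1 + 2) d.1.1.2
  & lattice_index d.1.1.1 d.1.1.2 n]].
have imD nu : pval1 nu -> [set H : set (semidirect nu) |
    [/\ open H, is_subgroup H & has_index H n]] = @subgroup_of nu 1 @` D.
  move=> nu_val; apply/seteqP; split=> [H [oH sH]|_ [[[[m L] v1] v2] [/= LL Ls Ln] <-]].
    have [m [v1 [v2 [HE Ls]]]] := open_subgroup_coord p_prime nu_val oH sH.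
    have LL := fiber0_lattice oH sH.
    rewrite {1}HE => /(has_index_coord_subgroupP p_prime v1 v2 n nu_val LL Ls) Ln.
    by exists (m, fiber0 H, v1, v2); rewrite /subgroup_of //= mul1r.
  split; [exact: coord_subgroup_open|exact: coord_subgroup_is_subgroup|].
  exact/(has_index_coord_subgroupP p_prime).
move=> mu_val mu'_val; rewrite /num_subgroups !imD //.
apply: card_eq_fset_set; apply: image_card_eq.
move=> [[[m L] v1] v2] [[[m' L'] v1'] v2'] /= [/= LL Ls _] [/= LL' Ls' _].
by rewrite /subgroup_of /= !mul1r !coord_subgroup_eqP.
Qed.

(** u^mu = u^mu' u^(mu - mu') differs from u^mu' by a multiple of p^5, whereas
    u^mu' - 1 is a unit times p^3. *)
Lemma ratio_exists mu mu' : pval1 mu -> pval1 mu' -> pdvd 3 (mu - mu') ->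
  exists k k', [/\ k * k' = 1, upow mu - 1 = (upow mu' - 1) * k, pdvd 2 (k - 1)
    & pdvd 2 (k' - 1)].
Proof.
move=> mu_val [nu [nu' nuV] eq_mu'] [z ez].
have [u [u' uV] eu] := upow_sub1_factor p_prime mu'.
have [w _ ew] := upow_sub1_factor p_prime (mu - mu').
pose d := upow mu' * z * w * nu' * u'.
have [k' kV] : punit (1 + pX 2 * d).
  apply: punitD => //; first exact: punit1.
  by exists (pX 1 * d); rewrite mulrA -exprD.
exists (1 + pX 2 * d), k'; split=> //.
- have -> : upow mu = upow mu' * (1 + (upow (mu - mu') - 1)).
    by rewrite addrC subrK -upowD addrC subrK.
  rewrite ew ez eu mulrDr mulr1 mulrDr mulr1 addrAC eu; congr (_ + _).
  transitivity (pX 5 * (upow mu' * z * w) * (nu * nu') * (u * u')); last first.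
    by rewrite /d eq_mu'; ring.
  by rewrite nuV uV; ring.
- by exists d; rewrite addrC addKr.
- exists (- (k' * d)).
  by transitivity (k' - (1 + pX 2 * d) * k'); [rewrite kV|ring].
Qed.

Lemma num_normal_subgroups_indep mu mu' n : pval1 mu -> pval1 mu' ->
  pdvd 3 (mu - mu') ->
  num_normal_subgroups (semidirect mu) n = num_normal_subgroups (semidirect mu') n.
Proof.
move=> mu_val mu'_val mumu'.
have [k [k' [kV Ek k1 k'1]]] := ratio_exists mu_val mu'_val mumu'.
pose D : set coord := [set d | [/\ lattice d.1.1.2, normal_lattice d.1.1.1 d.1.1.2,
  lattice_index d.1.1.1 d.1.1.2 n &
  d.1.1.2 ((upow 1 - 1) * d.1.2) ((upow mu - 1) * d.2)]].
have imD nu l l' : pval1 nu -> l * l' = 1 -> upow mu - 1 = (upow nu - 1) * l ->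
    [set H : set (semidirect nu) |
      [/\ open H, is_normal_subgroup H & has_index H n]] = @subgroup_of nu l @` D.
  move=> nu_val lV El; apply/seteqP.
  split=> [H [oH nH]|_ [[[[m L] v1] v2] [/= LL Ln Li Lv] <-]].
    have sH := nH.1.
    have [m [v1 [v2 [HE Ls]]]] := open_subgroup_coord p_prime nu_val oH sH.
    have LL := fiber0_lattice oH sH.
    have lv2 : l * (l' * v2) = v2 by rewrite mulrA lV mul1r.
    rewrite {1}HE => /(has_index_coord_subgroupP p_prime v1 v2 n nu_val LL Ls) Li.
    exists (m, fiber0 H, v1, l' * v2); last by rewrite /subgroup_of /= lv2.
    have := (coord_subgroup_normalP p_prime nu_val v1 v2 LL Ls).1.
    rewrite -HE => /(_ nH)[Ln Lv].
    by split=> //=; rewrite El -mulrA lv2.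
  have Ls := normal_lattice_ystable LL Ln.
  split; [exact: coord_subgroup_open|apply/(coord_subgroup_normalP p_prime)|] => //.
    by split=> //; rewrite mulrA -El.
  exact/(has_index_coord_subgroupP p_prime).
rewrite /num_normal_subgroups (imD mu 1 1) ?mulr1 // (imD mu' k k') //.
apply: card_eq_fset_set; apply: image_card_eq.
move=> [[[m L] v1] v2] [[[m' L'] v1'] v2'] /= [/= LL Ln _ _] [/= LL' Ln' _ _].
have Ls := normal_lattice_ystable LL Ln; have Ls' := normal_lattice_ystable LL' Ln'.
rewrite /subgroup_of /= !mul1r !coord_subgroup_eqP // -mulrBr.
have [L2 _ _] := Ln.
split=> -[em eL Lv]; split=> //.
  by have := lattice_diag LL L2 k1 Lv; rewrite mul1r.
have := lattice_diag LL L2 k'1 Lv; congr L; first by ring.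
by rewrite mulrA [k' * k]mulrC kV mul1r.
Qed.

End Isospectral.

(** * Recovering the exponent from the commensurability class *)

Section Commensurable.
Variable q : nat.
Local Notation p := q.+2.
Local Notation padic := (padic q).
Local Notation pX n := (p%:R ^+ n : padic).
Implicit Types mu : padic.
Hypothesis p_prime : prime p.

Section Isomorphism.
Variables (mu mu' : padic).
Local Notation G1 := (semidirect mu).
Local Notation G2 := (semidirect mu').
Local Notation elt1 := (Semidirect mu).
Local Notation elt2 := (Semidirect mu').
Variables (H1 : set G1) (H2 : set G2) (f : G1 -> G2).
Hypotheses (oH1 : open H1) (sH1 : is_subgroup H1).
Hypotheses (oH2 : open H2) (sH2 : is_subgroup H2).
Hypotheses (f_bij : set_bij H1 H2 f) (f_cont : {within H1, continuous f}).
Hypothesis f_morph : {in H1 &, {morph f : x y / (x * y)%g}}.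

Lemma iso_mul x y : H1 x -> H1 y -> f (x * y)%g = (f x * f y)%g.
Proof. by move=> ? ?; apply: f_morph; apply/mem_set. Qed.

Lemma iso_one : f 1%g = 1%g.
Proof.
have /is_subgroupP[H11 _ _] := sH1.
have := iso_mul H11 H11; rewrite mulg1 => e.
by rewrite -[LHS](mulKg (f 1%g)) -e mulVg.
Qed.

Lemma iso_inv x : H1 x -> f (x^-1)%g = ((f x)^-1)%g.
Proof.
have /is_subgroupP[_ _ HV] := sH1; move=> Hx.
have := iso_mul (HV _ Hx) Hx; rewrite mulVg iso_one => e.
by rewrite -[LHS](mulgK (f x)) -e mul1g.
Qed.

Lemma iso_conj x y : H1 x -> H1 y -> f (x ^ y)%g = (f x ^ f y)%g.
Proof.
have /is_subgroupP[_ HM HV] := sH1; move=> Hx Hy.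
by rewrite /conjg !iso_mul ?iso_inv //; [exact: HV|exact: HM].
Qed.

Lemma iso_exp x n : H1 x -> f (x ^+ n)%g = (f x ^+ n)%g.
Proof.
move=> Hx; elim: n => [|n IHn]; first by rewrite !expg0 iso_one.
by rewrite !expgS iso_mul ?IHn //; apply: subgroup_exp.
Qed.

(** An element of the plane commutes with all its conjugates. An element
    (r, x, y) with r <> 0 does not commute with its conjugate by (0, c, 0) when
    c <> 0: the first plane coordinate of the commutator is (u^r - 1)^2 c up to
    a unit. *)
Lemma iso_fiber x y : H1 (elt1 0 x y) -> tc (f (elt1 0 x y)) = 0.
Proof.
set w := elt1 0 x y => Hw; set r := tc (f w).
have [_ _ f_surj] := f_bij.
have [N HN] := open_subgroup_near1 oH2 sH2; have /is_subgroupP[_ HM HV] := sH1.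
have Hy : H2 (elt2 0 (pX N) 0).
  by apply: HN; have := gcongr_near1 mu' N 0 1 0; rewrite !mulr0 mulr1.
have [h Hh fh] := f_surj _ Hy.
have Hwh : H1 (w ^ h)%g by rewrite /conjg; apply: (HM); [exact: HV|exact: HM].
have comm : (w * w ^ h)%g = (w ^ h * w)%g.
  rewrite conjg_semidirect /= !mulr0 !upow0 !subrr !mul0r !subr0.
  by rewrite !mulgV_elt; apply: semidirect_eq; rewrite //= addrC.
have := congr1 (@xc _ _ \o f) comm.
rewrite /= (iso_mul Hw Hwh) (iso_mul Hwh Hw) (iso_conj Hw Hh) fh.
rewrite conjg_semidirect !xcM /= -/r upow0 mul1r => e.
apply: contrapT => r0; have Er0 := upow_sub1_neq0 p_prime r0.
suff : (upow r - 1) * ((upow r - 1) * pX N) = 0.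
  by move=> /(padic_mul0 p_prime Er0)/(padic_mul0 p_prime Er0); apply: pX_neq0.
apply: (@addIr _ (upow r * (xc (f w) - (upow r - 1) * pX N) + xc (f w))).
by rewrite add0r -{2}e; ring.
Qed.

(** f is linear over the natural numbers; continuity gives the rest. *)
Lemma iso_fiber_linear x y x' y' c : (forall a, H1 (elt1 0 (a * x) (a * y))) ->
  f (elt1 0 x y) = elt2 0 x' y' ->
  f (elt1 0 (c * x) (c * y)) = elt2 0 (c * x') (c * y').
Proof.
move=> Ha fw; apply: gcongr_eq => n.
have Hw : H1 (elt1 0 x y) by have := Ha 1; rewrite !mul1r.
have := f_cont; rewrite continuous_open_subspace // => fc.
have [M HM] := fc _ (mem_set (Ha c)) _ (nbhs_gcongr n _).
set K := maxn M n; have ck : c K = ((c K)%:R : padic) K by rewrite digits_nat digits_mod.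
have cong nu a b : gcongr K (Semidirect nu 0 (c * a) (c * b))
    (Semidirect nu 0 ((c K)%:R * a) ((c K)%:R * b)).
  by split=> //=; apply: digits_congrM.
have := HM _ (gcongr_le (leq_maxl M n) (cong mu x y)).
rewrite /= -expg_V iso_exp // fw expg_V => h; apply: gcongr_trans h _.
by apply/gcongr_sym/(gcongr_le (leq_maxr M n))/cong.
Qed.

Lemma iso_fiber_eigen x0 x y a : H1 x0 -> (x, y) <> (0, 0) ->
  (forall c, H1 (elt1 0 (c * x) (c * y))) ->
  upow (tc x0) * x = a * x -> upow (mu * tc x0) * y = a * y ->
  exists x' y', [/\ (x', y') <> (0, 0),
    upow (tc (f x0)) * x' = a * x' & upow (mu' * tc (f x0)) * y' = a * y'].
Proof.
move=> Hx0 xy0 Ha ex ey.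
have Hw : H1 (elt1 0 x y) by have := Ha 1; rewrite !mul1r.
have fw := iso_fiber Hw; set w := elt1 0 x y in Hw fw.
have fwE : f w = elt2 0 (xc (f w)) (yc (f w)) by rewrite -fw; case: (f w).
exists (xc (f w)), (yc (f w)); split.
- move=> [fx fy]; have [_ f_inj _] := f_bij; have /is_subgroupP[H11 _ _] := sH1.
  have : w = 1%g.
    apply: f_inj; [exact/mem_set|exact/mem_set|].
    by rewrite fwE fx fy iso_one.
  by move=> [wx wy]; apply: xy0; rewrite wx wy.
all: have : f (w ^ x0)%g = (elt2 0 (xc (f w)) (yc (f w)) ^ f x0)%g
  by rewrite -fwE iso_conj.
all: have -> : (w ^ x0)%g = elt1 0 (a * x) (a * y)
  by rewrite conjg_semidirect /= !mulr0 !upow0 !subrr !mul0r !subr0 ex ey.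
all: rewrite (iso_fiber_linear a Ha fwE) conjg_semidirect /= !mulr0 !upow0.
all: rewrite !subrr !mul0r !subr0 => h.
  exact: (esym (congr1 (@xc _ _) h)).
exact: (esym (congr1 (@yc _ _) h)).
Qed.

End Isomorphism.

Lemma pval1_nunit mu x : pval1 mu -> mu * x <> 1.
Proof.
move=> [nu _ ->] e; have [] : (p%:R : padic) 1 <> 0%N.
  by apply: punit_neq0; exists (nu * x); rewrite mulrA.
by rewrite digits_nat expn1 modnn.
Qed.

Lemma eigen_eq x s s' : x <> 0 -> upow s * x = upow s' * x -> s = s' :> padic.
Proof.
move=> x0; rewrite ![_ * x]mulrC => /(padic_mulI p_prime x0); exact: upow_inj.
Qed.

(** The eigenvalues of t^(p^N) on the two axes, compared with those of its
    image. *)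
Lemma commensurable_eq mu mu' : pval1 mu -> pval1 mu' ->
  commensurable (semidirect mu) (semidirect mu') -> mu = mu'.
Proof.
move=> mu_val mu'_val [H1 [H2 [oH1 sH1 oH2 sH2 [f [g [f_bij _ fM fc _]]]]]].
have [N HN] := open_subgroup_near1 oH1 sH1; set s0 := pX N.
have s0_neq0 : s0 <> 0 by exact: pX_neq0.
have Hx0 : H1 (Semidirect mu s0 0 0).
  by apply: HN; have := gcongr_near1 mu N 1 0 0; rewrite !mulr0 mulr1.
have He1 c : H1 (Semidirect mu 0 (c * s0) (c * 0)).
  by apply: HN; have := gcongr_near1 mu N 0 c 0; rewrite !mulr0 mulrC.
have He2 c : H1 (Semidirect mu 0 (c * 0) (c * s0)).
  by apply: HN; have := gcongr_near1 mu N 0 0 c; rewrite !mulr0 mulrC.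
have [x1 [y1 [xy1 ex1 ey1]]] : exists x' y', [/\ (x', y') <> (0, 0),
    upow (tc (f (Semidirect mu s0 0 0))) * x' = upow s0 * x' &
    upow (mu' * tc (f (Semidirect mu s0 0 0))) * y' = upow s0 * y'].
  apply: (iso_fiber_eigen oH1 sH1 oH2 sH2 f_bij fc fM Hx0 _ He1) => //=.
    by case.
  by rewrite !mulr0.
have [x2 [y2 [xy2 ex2 ey2]]] : exists x' y', [/\ (x', y') <> (0, 0),
    upow (tc (f (Semidirect mu s0 0 0))) * x' = upow (mu * s0) * x' &
    upow (mu' * tc (f (Semidirect mu s0 0 0))) * y' = upow (mu * s0) * y'].
  apply: (iso_fiber_eigen oH1 sH1 oH2 sH2 f_bij fc fM Hx0 _ He2) => //=.
    by case.
  by rewrite !mulr0.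
set s := tc _ in ex1 ey1 ex2 ey2.
have mu1 : mu * s0 <> s0.
  rewrite mulrC -[RHS]mulr1 => /(padic_mulI p_prime s0_neq0) mu1.
  by apply: (@pval1_nunit mu 1) => //; rewrite mulr1.
(* x1 = 0 would mean that f exchanges the two axes. *)
have [x10|/eqP x10] := eqVneq x1 0.
  have y10 : y1 <> 0 by move=> y10; apply: xy1; rewrite x10 y10.
  have es0 := eigen_eq y10 ey1.
  have [x20|/eqP x20] := eqVneq x2 0.
    have y20 : y2 <> 0 by move=> y20; apply: xy2; rewrite x20 y20.
    by case: mu1; rewrite -(eigen_eq y20 ey2) es0.
  have es := eigen_eq x20 ex2; case: (@pval1_nunit mu' mu) => //.
  apply: (padic_mulI p_prime s0_neq0); rewrite mulr1 -[RHS]es0 es; ring.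
have es0 := eigen_eq x10 ex1.
have [y20|/eqP y20] := eqVneq y2 0.
  have x20 : x2 <> 0 by move=> x20; apply: xy2; rewrite x20 y20.
  by case: mu1; rewrite -(eigen_eq x20 ex2) es0.
have := eigen_eq y20 ey2; rewrite es0 ![_ * s0]mulrC => /(padic_mulI p_prime s0_neq0).
by [].
Qed.

(** ** An uncountable set of exponents *)

Lemma compat_digit_sum (S : set nat) :
  compatible q (fun n => \sum_(i < n) `[< S i >] * p ^ i)%N.
Proof. by move=> n; rewrite big_ord_recr /= addnC modnMDl. Qed.

(** The p-adic integer whose digits are the characteristic function of S. *)
Definition digit_set S := padic_of (compat_digit_sum S).

Lemma digit_sum_lt (S : set nat) n : (\sum_(i < n) `[< S i >] * p ^ i < p ^ n)%N.
Proof.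
elim: n => [|n IHn]; first by rewrite big_ord0.
rewrite big_ord_recr /= expnS !mulSn addnA; apply: leq_trans (leq_addr _ _).
rewrite -addSn leq_add //; by case: `[< S n >]; rewrite ?mul1n.
Qed.

Lemma digit_set_inj : injective digit_set.
Proof.
move=> S T e; have {}e n : (\sum_(i < n) `[< S i >] * p ^ i =
    \sum_(i < n) `[< T i >] * p ^ i)%N.
  have := congr1 (fun x => digits x n) e.
  by rewrite /= !modn_small ?digit_sum_lt.
apply/funext => n; apply/propext.
have := e n.+1; rewrite !big_ord_recr /= e => /addnI/eqP.
rewrite eqn_pmul2r ?expn_gt0 // => /eqP.
by case: asboolP => Sn; case: asboolP => Tn // _; split.
Qed.

(** Valuation 1 and a common residue modulo p^3 are what the comparison of
    normal subgroups requires. *)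
Definition exponent S : padic := p%:R + pX 3 * digit_set S.

Lemma exponent_pval1 S : pval1 (exponent S).
Proof.
exists (1 + pX 2 * digit_set S); last by rewrite /exponent; ring.
apply: punitD => //; first exact: punit1.
by exists (pX 1 * digit_set S); rewrite mulrA -exprD.
Qed.

Lemma exponent_inj : injective exponent.
Proof. by move=> S T /addrI/pX_mulI/digit_set_inj. Qed.

Lemma exponent_congr S T : pdvd 3 (exponent S - exponent T).
Proof. by exists (digit_set S - digit_set T); rewrite /exponent; ring. Qed.

End Commensurable.

Theorem corollary1p3 (p : nat) (p_prime : prime p) :
  (exists (I : Type) (G : I -> topGroupType),
     [/\ ~ countable [set: I],
         forall i : I, pro_p_group (G i) p /\ top_finitely_generated (G i),
         forall i j : I, i <> j -> ~ commensurable (G i) (G j)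
       & forall i j : I, isospectral (G i) (G j)]) /\
  (exists (I : Type) (G : I -> topGroupType),
     [/\ ~ countable [set: I],
         forall i : I, pro_p_group (G i) p /\ top_finitely_generated (G i),
         forall i j : I, i <> j -> ~ commensurable (G i) (G j)
       & forall i j : I, normally_isospectral (G i) (G j)]).
Proof.
case: p p_prime => [|[|q]] // p_prime.
pose G (S : set nat) : topGroupType := semidirect (exponent q S).
have val S := exponent_pval1 p_prime S.
have Gprop S : pro_p_group (G S) q.+2 /\ top_finitely_generated (G S).
  by split; [exact: semidirect_pro_p|exact: semidirect_fg].
have Gcomm S T : S <> T -> ~ commensurable (G S) (G T).
  move=> ST /(commensurable_eq p_prime (val S) (val T)) /exponent_inj; exact: ST.
split; exists (set nat), G; split=> //; try exact: set_nat_uncountable.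
- by move=> S T; apply/funext => n; apply: num_subgroups_indep.
- move=> S T; apply/funext => n; apply: num_normal_subgroups_indep => //.
  exact: exponent_congr.
Qed.
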